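(* The domain $\Omega_a$ converges to the strip $S$ in the sense that for all $b>0$, $$\psi_a \to 1 \quad\text{uniformly in } [-b,b] \text{ as } a\to+\infty .$$ Moreover, for every $b>0$, $$u_a\to u_S \quad\text{in } H^1(R(b)) \text{ as } a\to\infty .$$
   Context: Work in $\mathbb{R}^2$ with Cartesian coordinates $(x_1,x_2)$ and let $\mathbb{R}^2_+=\{x_1>0\}$. For $a>0$ let $K_a=\{0\}\times[-a,a]$. The admissible shapes are the open convex sets $\Omega$ with $K_a\subset\partial\Omega$ and $\Omega\subset\{x_1\ge 0\}$. Consider the free boundary problem: find such an $\Omega$ and $u:\Omega\to\mathbb{R}$ with $-\Delta u=0$ in $\Omega$, $u=1$ on $K_a$, $u=0$ on $\partial\Omega\setminus K_a$, and $|\nabla u|=1$ on $\Gamma_a:=(\partial\Omega\setminus K_a)\cap\mathbb{R}^2_+$. This problem has a unique solution, denoted $(\Omega_a,u_a)$; $\partial\Omega_a$ is $C^{2+\alpha}$ for $0<\alpha<1$. The curve $\Gamma_a\cap\{-a\le x_2\le a\}$ is the graph $x_1=\psi_a(x_2)$ of a concave $C^{2,\alpha}$ function $\psi_a$ on $[-a,a]$. Let $S=]0,1[\times\mathbb{R}$ be the infinite open strip, $R(b)=]0,1[\times]-b,b[$ for $b>0$, and $u_S(x)=1-x_1$ on $S$. The function $u_a$ is extended by zero to all of $S$ (it is shown that $\Omega_a\subset S$). *)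

(* Defs.v *)
From HB Require Import structures.
From mathcomp Require Import all_boot all_order all_algebra.
From mathcomp Require Import all_classical all_reals all_analysis.
Set Implicit Arguments. Unset Strict Implicit. Unset Printing Implicit Defensive.
Import Order.TTheory GRing.Theory Num.Theory.
Import numFieldNormedType.Exports.
Local Open Scope classical_set_scope.
Local Open Scope ring_scope.

Section FB.
Variable R : realType.
Notation P := (R * R)%type.

(* partial derivatives d/dx1, d/dx2 (values are meaningful where they exist) *)
Definition d1 (f : P -> R) (p : P) : R := derive1 (fun t => f (t, p.2)) p.1.
Definition d2 (f : P -> R) (p : P) : R := derive1 (fun t => f (p.1, t)) p.2.

Definition has_partials (f : P -> R) (p : P) : Prop :=
  derivable (fun t => f (t, p.2)) p.1 1 /\ derivable (fun t => f (p.1, t)) p.2 1.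

Definition C1_on (D : set P) (f : P -> R) : Prop :=
  forall p, D p -> [/\ has_partials f p, {for p, continuous f},
                      {for p, continuous (d1 f)} & {for p, continuous (d2 f)}].

Definition C2_on (D : set P) (f : P -> R) : Prop :=
  C1_on D f /\ C1_on D (d1 f) /\ C1_on D (d2 f).

Definition laplacian (f : P -> R) (p : P) : R := d1 (d1 f) p + d2 (d2 f) p.

Definition convex_set (D : set P) : Prop :=
  forall p q t, D p -> D q -> 0 <= t <= 1 ->
    D ((1 - t) * p.1 + t * q.1, (1 - t) * p.2 + t * q.2).

Definition Kseg (a : R) : set P := [set p | p.1 = 0 /\ - a <= p.2 <= a].

(* boundary of an open set *)
Definition bdry (D : set P) : set P := closure D `\` D.

Definition Gamma (a : R) (D : set P) : set P :=
  [set p | bdry D p /\ ~ Kseg a p /\ 0 < p.1].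

(* Classical solution of the free boundary problem:
   Omega open convex, K_a in dOmega, Omega in {x1 >= 0};
   u in C^2(Omega), bounded, harmonic;
   u -> 1 at points of K_a (corners (0,+-a) excluded, where the data jump),
   u -> 0 at points of dOmega \ K_a;
   grad u extends continuously to Gamma_a with |grad u| = 1 there. *)
Definition fb_solution (a : R) (Om : set P) (u : P -> R) : Prop :=
  [/\ [/\ open Om, convex_set Om, Kseg a `<=` bdry Om & Om `<=` [set p | 0 <= p.1]],
      C2_on Om u /\ (exists M, forall p, Om p -> `|u p| <= M),
      (forall p, Om p -> laplacian u p = 0),
      (forall p, Kseg a p -> - a < p.2 < a -> u @ within Om (nbhs p) --> (1:R))
      /\ (forall p, bdry Om p -> ~ Kseg a p -> u @ within Om (nbhs p) --> (0:R)) &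
      (forall p, Gamma a Om p -> exists g1 g2 : R,
          [/\ d1 u @ within Om (nbhs p) --> g1, d2 u @ within Om (nbhs p) --> g2
            & g1 ^+ 2 + g2 ^+ 2 = 1])].

Definition ext0 (Om : set P) (u : P -> R) : P -> R :=
  fun p => if `[< Om p >] then u p else 0.

Definition uS (p : P) : R := 1 - p.1.

Definition Rect (b : R) : set P := `]0, 1[ `*` `]- b, b[.

Definition leb2 := ((@lebesgue_measure R) \x (@lebesgue_measure R))%E.

Definition test_fun (U : set P) (phi : P -> R) : Prop :=
  C1_on setT phi /\
  exists C : set P, [/\ compact C, C `<=` U & forall p, ~ C p -> phi p = 0].

Definition weak_grad (U : set P) (f g1 g2 : P -> R) : Prop :=
  forall phi, test_fun U phi ->
    (\int[leb2]_(p in U) (f p * d1 phi p)%:E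
       = - \int[leb2]_(p in U) (g1 p * phi p)%:E)%E /\
    (\int[leb2]_(p in U) (f p * d2 phi p)%:E
       = - \int[leb2]_(p in U) (g2 p * phi p)%:E)%E.

(* squared H^1(U) distance between f (weak gradient g1,g2) and the smooth uS *)
Definition H1dist2_uS (U : set P) (f g1 g2 : P -> R) : \bar R :=
  (\int[leb2]_(p in U)
     ((f p - uS p) ^+ 2 + (g1 p - d1 uS p) ^+ 2 + (g2 p - d2 uS p) ^+ 2)%:E)%E.

End FB.

(* Main.v *)
Require Import Defs.
From HB Require Import structures.
From mathcomp Require Import all_boot all_order all_algebra.
From mathcomp Require Import all_classical all_reals all_analysis.
From mathcomp Require Import measurable_realfun ring lra.
Set Implicit Arguments. Unset Strict Implicit. Unset Printing Implicit Defensive.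
Import Order.TTheory GRing.Theory Num.Theory.
Import numFieldNormedType.Exports.
Local Open Scope classical_set_scope.
Local Open Scope ring_scope.

(* Everything follows from the maximum principle, applied with harmonic
   polynomials as barriers.

   First, [0 <= u <= 1]; the corners of [K_a] and infinity, where no boundary
   value is prescribed, are handled with a logarithmic potential. Let [p] be a
   free boundary point, [s] the distance to a supporting line of [Om] at [p] and
   [t] the orthogonal coordinate. The barrier [(t^2 - s^2)/r^2 + 2s/r] on the disk
   of radius [r] about [p] bounds the slope of [u] at [p] by [2/r], and
   [|grad u| = 1] then gives [psi <= 5] on [[-a/2, a/2]].

   Next, fix [y0] and compare [u] on [|y - y0| < a/4] with
   [1 - k x +/- d ((y - y0)^2 - x^2)], [d = 64/a^2], where [k] is the extremal
   value for which this polynomial keeps a sign on the graph. It vanishes at some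
   point of the graph, and [|grad u| = 1] there forces [k = 1 + O(1/a^2)]. Hence
   [|u - (1 - x)| <= 900 x/a^2], which contains the convergence of [psi].

   The gradient of a bounded harmonic function is estimated by comparing its odd
   reflection with a barrier. This turns the previous bound into [grad u ->
   (-1, 0)] uniformly on [x <= 1 - 2e], while near the graph the barrier at a
   supporting line keeps [grad u] bounded; the remaining layer has measure
   [O(e)]. Finally the extension by zero of [grad u] is the weak gradient:
   integrate by parts for a [C^1] truncation of [u] vanishing near the free
   boundary and pass to the limit. *)

(** Boundary data are known only as limits: nothing at the corners or at infinity, and at a free
    boundary point only that [u] tends to 0 while its gradient has some unit limit of unknown
    direction. Comparisons are therefore stated with one-sided limits, and the gradient condition is
    exploited at a single contact point of a barrier. The direction is controlled by the length of
    the domain: concavity of [psi] on [[-a, a]] places at each graph point a cone inside [Om] with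
    opening of order [a / psi]; positivity of [u] along its sides makes the vertical gradient
    component [O(1/a)], so the horizontal one is [1 - O(1/a^2)] in size. The constant [d = 64/a^2]
    balances two demands: on the sides of the window [d (a/4)^2 = 4] must outweigh all other terms,
    while the slope added at the contact point, at most [10 d], must stay [O(1/a^2)]. The strip
    estimate is proportional to [x] because the gradient is then estimated on disks of radius [e x],
    which shrink towards [K_a]. *)

Section EpsDelta.
Variable R : realType.
Notation P := (R * R)%type.
Implicit Types (p q x : P) (D : set P).

Lemma nbhs_boxP p (A : set P) : nbhs p A <->
  exists2 e : R, 0 < e & forall q, `|q.1 - p.1| < e -> `|q.2 - p.2| < e -> A q.
Proof.
split.
  move=> /nbhs_ballP[e /= e0 h]; exists e => // q q1 q2; apply: h.
  by split => /=; rewrite /ball /= distrC.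
move=> [e e0 h]; apply/nbhs_ballP; exists e => //= q [q1 q2].
by apply: h; rewrite distrC.
Qed.

Lemma cvg_within_boxP D (f : P -> R) q (c : R) : f @ within D (nbhs q) --> c <->
  forall e, 0 < e -> exists2 d : R, 0 < d & forall x, D x ->
    `|x.1 - q.1| < d -> `|x.2 - q.2| < d -> `|f x - c| < e.
Proof.
split.
  move=> /cvgrPdist_lt h e /h; rewrite /prop_near1 /within /=.
  move=> /nbhs_boxP[d d0 hd]; exists d => // x Dx x1 x2.
  by rewrite distrC; apply: hd.
move=> h; apply/cvgrPdist_lt => e /h[d d0 hd]; rewrite /prop_near1 /within /=.
by apply/nbhs_boxP; exists d => // x x1 x2 Dx; rewrite distrC; apply: hd.
Qed.

Lemma cvg_boxP (f : P -> R) q (c : R) : f @ q --> c <->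
  forall e, 0 < e -> exists2 d : R, 0 < d & forall x,
    `|x.1 - q.1| < d -> `|x.2 - q.2| < d -> `|f x - c| < e.
Proof.
split.
  move=> /cvgrPdist_lt h e /h.
  move=> /nbhs_boxP[d d0 hd]; exists d => // x x1 x2.
  by rewrite distrC; apply: hd.
move=> h; apply/cvgrPdist_lt => e /h[d d0 hd].
by apply/nbhs_boxP; exists d => // x x1 x2; rewrite distrC; apply: hd.
Qed.

Lemma open_boxP D p : open D -> D p ->
  exists2 e : R, 0 < e & forall q, `|q.1 - p.1| < e -> `|q.2 - p.2| < e -> D q.
Proof. by rewrite openE => /[apply] /nbhs_boxP. Qed.

Lemma closure_boxP D q : closure D q <->
  forall e, 0 < e -> exists2 x, D x & `|x.1 - q.1| < e /\ `|x.2 - q.2| < e.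
Proof.
split.
  move=> h e e0; have [|x [Dx [x1 x2]]] := h [set x | `|x.1 - q.1| < e /\ `|x.2 - q.2| < e].
    by apply/nbhs_boxP; exists e.
  by exists x.
move=> h B /nbhs_boxP[e /h[x Dx [x1 x2]] hB]; exists x; split => //.
exact: hB.
Qed.

Lemma exists_small (x y z w : R) : 0 < x -> 0 < y -> 0 < z -> 0 < w ->
  exists t, [/\ 0 < t, t < x, t < y, t < z & t < w].
Proof.
move=> x0 y0 z0 w0; pose m := Num.min (Num.min x y) (Num.min z w).
have m0 : 0 < m by rewrite !lt_min x0 y0 z0 w0.
have mm : m / 2 < m by rewrite ltr_pdivrMr // ltr_pMr // ltr1n.
exists (m / 2); split; first exact: divr_gt0.
all: by apply: (lt_le_trans mm); rewrite !ge_min lexx ?orbT.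
Qed.

(** A first-order expansion that also makes sense at [h = 0]; locality, reflection and slope
    arguments are read off from it. *)
Lemma is_derive_epsP (f : R -> R) (c l : R) : is_derive c 1 f l <->
  forall e, 0 < e -> exists2 d, 0 < d &
    forall h, `|h| < d -> `|f (c + h) - f c - l * h| <= e * `|h|.
Proof.
have key : ((fun h => h^-1 *: (f (h *: (1:R) + c) - f c)) @ 0^' --> l) <->
  forall e, 0 < e -> exists2 d, 0 < d &
    forall h, `|h| < d -> `|f (c + h) - f c - l * h| <= e * `|h|.
  split.
    move=> /cvgrPdist_le h e e0; have /nbhs_ballP[d /= d0 hd] := h _ e0.
    exists d => // k kd; have [->|k0] := eqVneq k 0.
      by rewrite addr0 subrr mulr0 subr0 normr0 mulr0.
    have := hd k; rewrite /ball /= sub0r normrN => /(_ kd k0).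
    rewrite /GRing.scale /= mulr1 (addrC k) => hk.
    have -> : f (c + k) - f c - l * k = - ((l - k^-1 * (f (c + k) - f c)) * k).
      by field.
    by rewrite normrN normrM ler_wpM2r.
  move=> h; apply/cvgrPdist_le => e /h[d d0 hd].
  apply/nbhs_ballP; exists d => //= k; rewrite /ball /= sub0r normrN => kd k0.
  have := hd _ kd; rewrite /GRing.scale /= mulr1 (addrC k).
  have -> : f (c + k) - f c - l * k = - ((l - k^-1 * (f (c + k) - f c)) * k).
    by field.
  by rewrite normrN normrM ler_pM2r // normr_gt0.
rewrite -key; split => [[dv <-]|h].
  exact: dv.
split; first by apply/cvg_ex; exists l.
exact/cvg_lim.
Qed.

Lemma is_derive_loc (f g : R -> R) (c l e : R) : 0 < e ->
  (forall t, `|t - c| < e -> f t = g t) -> is_derive c 1 f l -> is_derive c 1 g l.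
Proof.
move=> e0 fg /is_derive_epsP H; apply/is_derive_epsP => k /H[d d0 hd].
exists (Num.min d e) => [|h]; first by rewrite lt_min d0.
rewrite lt_min => /andP[hd' he]; rewrite -!fg.
- exact: hd.
- by rewrite subrr normr0.
- by rewrite addrC addKr.
Qed.

(** If [l > 0], then [f1], which vanishes at the maximum, is positive just to the right of [c], and
    the mean value theorem produces a larger value of [f] there. *)
Lemma second_derivative_max (f f1 : R -> R) (c l e : R) : 0 < e ->
  (forall t, `|t - c| < e -> is_derive t 1 f (f1 t)) -> is_derive c 1 f1 l ->
  (forall t, `|t - c| < e -> f t <= f c) -> l <= 0.
Proof.
move=> e0 df df1 fmax; rewrite leNgt; apply/negP => l0.
have itvE t : (t \in `]c - e, c + e[) = (`|t - c| < e).
  by rewrite in_itv /= ltr_distl.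
have f1c : f1 c = 0.
  have : is_derive c 1 f 0.
    apply: (@derive1_at_max _ f (c - e) (c + e)).
    - lra.
    - by move=> t; rewrite itvE => /df[].
    - by rewrite itvE subrr normr0.
    - by move=> t; rewrite itvE => /fmax.
  have := df c; rewrite subrr normr0 => /(_ e0) h1 h2.
  by rewrite -(@derive_val _ _ _ _ _ _ _ h1) (@derive_val _ _ _ _ _ _ _ h2).
have /is_derive_epsP/(_ (l / 2)) := df1; rewrite divr_gt0 // => /(_ isT)[d d0 hd].
pose m := Num.min d e / 2.
have m0 : 0 < m by rewrite divr_gt0 // lt_min d0.
have [md me] : m < d /\ m < e.
  have : Num.min d e <= d by rewrite ge_min lexx.
  have : Num.min d e <= e by rewrite ge_min lexx orbT.
  rewrite /m in m0 *; lra.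
have [|||x] := @MVT R f f1 c (c + m); first lra.
- move=> x; rewrite in_itv /= => /andP[x1 x2]; apply: df.
  rewrite ltr_distl; lra.
- apply: derivable_within_continuous => x; rewrite in_itv /= => /andP[x1 x2].
  have [] : is_derive x 1 f (f1 x) by apply: df; rewrite ltr_distl; lra.
  by [].
rewrite in_itv /= => /andP[x1 x2].
have := fmax (c + m); rewrite (_ : c + m - c = m); last by ring.
rewrite gtr0_norm // => /(_ me) fm fE.
have := hd (x - c); rewrite f1c subr0 (_ : c + (x - c) = x); last by ring.
rewrite gtr0_norm; last lra.
have -> : x - c < d by lra.
move=> /(_ isT); rewrite ler_distl => /andP[lo _].
have : 0 < f1 x by nra.
by move=> f1x; nra.
Qed.

End EpsDelta.

(** * Harmonic functions and the maximum principle *)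

Section MaxPrinciple.
Variable R : realType.
Notation P := (R * R)%type.
Implicit Types (p q x : P) (D : set P).

(** First partials are existential functions and second ones pointwise numbers, so closure under
    sums, multiples and reflections amounts to exhibiting derivatives. This is the regularity that
    the maximum principle consumes. *)
Definition harmonic_on D (w : P -> R) : Prop := exists w1 w2 : P -> R,
  forall p, D p -> {for p, continuous w} /\ exists w11 w22 : R,
    [/\ is_derive p.1 1 (fun t => w (t, p.2)) (w1 p),
        is_derive p.2 1 (fun t => w (p.1, t)) (w2 p),
        is_derive p.1 1 (fun t => w1 (t, p.2)) w11,
        is_derive p.2 1 (fun t => w2 (p.1, t)) w22 & w11 + w22 = 0].

Lemma harmonic_ext D w v : w =1 v -> harmonic_on D w -> harmonic_on D v.
Proof. by move=> /funext ->. Qed.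

Lemma harmonicD D w v : harmonic_on D w -> harmonic_on D v ->
  harmonic_on D (fun p => w p + v p).
Proof.
move=> [w1 [w2 hw]] [v1 [v2 hv]].
exists (fun p => w1 p + v1 p), (fun p => w2 p + v2 p) => p Dp.
have [cw [w11 [w22 [a1 a2 a3 a4 a5]]]] := hw p Dp.
have [cv [v11 [v22 [b1 b2 b3 b4 b5]]]] := hv p Dp.
split; first exact: continuousD.
exists (w11 + v11), (w22 + v22); split.
- exact: (is_deriveD (f := fun t => w (t, p.2)) (g := fun t => v (t, p.2))).
- exact: (is_deriveD (f := fun t => w (p.1, t)) (g := fun t => v (p.1, t))).
- exact: (is_deriveD (f := fun t => w1 (t, p.2)) (g := fun t => v1 (t, p.2))).
- exact: (is_deriveD (f := fun t => w2 (p.1, t)) (g := fun t => v2 (p.1, t))).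
- by rewrite addrACA a5 b5 addr0.
Qed.

Lemma harmonicZ D w (k : R) : harmonic_on D w -> harmonic_on D (fun p => k * w p).
Proof.
move=> [w1 [w2 hw]].
exists (fun p => k * w1 p), (fun p => k * w2 p) => p Dp.
have [cw [w11 [w22 [a1 a2 a3 a4 a5]]]] := hw p Dp.
split; first by apply: (@continuousM _ _ (cst k)) => //; exact: cst_continuous.
exists (k * w11), (k * w22); split.
- exact: (is_deriveZ (f := fun t => w (t, p.2)) k).
- exact: (is_deriveZ (f := fun t => w (p.1, t)) k).
- exact: (is_deriveZ (f := fun t => w1 (t, p.2)) k).
- exact: (is_deriveZ (f := fun t => w2 (p.1, t)) k).
- by rewrite -mulrDr a5 mulr0.
Qed.

Lemma harmonicB D w v : harmonic_on D w -> harmonic_on D v ->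
  harmonic_on D (fun p => w p - v p).
Proof.
move=> hw /(@harmonicZ _ _ (-1)) /(harmonicD hw).
by apply: harmonic_ext => p; rewrite mulN1r.
Qed.

Lemma harmonic_sub D D' w : D' `<=` D -> harmonic_on D w -> harmonic_on D' w.
Proof. by move=> DD [w1 [w2 h]]; exists w1, w2 => p /DD /h. Qed.

Lemma harmonic_quadratic D (c a1 a2 b1 b2 : R) :
  harmonic_on D (fun p => c + a1 * p.1 + a2 * p.2 + b1 * (p.1 ^+ 2 - p.2 ^+ 2)
                       + b2 * (p.1 * p.2)).
Proof.
exists (fun p => a1 + 2 * b1 * p.1 + b2 * p.2), (fun p => a2 - 2 * b1 * p.2 + b2 * p.1).
move=> [x y] _ /=; split.
  have cx : {for (x, y), continuous (fun p : P => p.1)} by exact: cvg_fst.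
  have cy : {for (x, y), continuous (fun p : P => p.2)} by exact: cvg_snd.
  have cc (k : R) : {for (x, y), continuous (fun=> k : R)} by exact: cvg_cst.
  apply: continuousD; last first.
    by apply: continuousM; [exact: cc|exact: continuousM].
  apply: continuousD; last first.
    by apply: continuousM; [exact: cc|apply: continuousB; apply: continuousM].
  apply: continuousD; last exact: (continuousM (cc a2) cy).
  exact: (continuousD (cc c) (continuousM (cc a1) cx)).
exists (2 * b1), (- (2 * b1)); split; last by ring.
- by apply: is_derive_eq; rewrite /GRing.scale /=; ring.
- by apply: is_derive_eq; rewrite /GRing.scale /=; ring.
- by apply: is_derive_eq; rewrite /GRing.scale /=; ring.
- by apply: is_derive_eq; rewrite /GRing.scale /=; ring.
Qed.

Lemma harmonic_cst D (c : R) : harmonic_on D (fun=> c).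
Proof.
apply: harmonic_ext (@harmonic_quadratic D c 0 0 0 0) => p.
by rewrite !mul0r !addr0.
Qed.

Lemma harmonic_quadratic_at D (c a1 a2 b1 b2 x0 y0 : R) :
  harmonic_on D (fun p => c + a1 * (p.1 - x0) + a2 * (p.2 - y0)
    + b1 * ((p.1 - x0) ^+ 2 - (p.2 - y0) ^+ 2)
    + b2 * ((p.1 - x0) * (p.2 - y0))).
Proof.
apply: harmonic_ext (@harmonic_quadratic D
  (c - a1 * x0 - a2 * y0 + b1 * (x0 ^+ 2 - y0 ^+ 2) + b2 * (x0 * y0))
  (a1 - 2 * b1 * x0 - b2 * y0) (a2 + 2 * b1 * y0 - b2 * x0) b1 b2) => p.
by ring.
Qed.

Lemma harmonic_continuous D w p : harmonic_on D w -> D p -> {for p, continuous w}.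
Proof. by move=> [w1 [w2 h]] /h[]. Qed.

Lemma compact_box (B : R) : compact [set p : P | `|p.1| <= B /\ `|p.2| <= B].
Proof.
rewrite (_ : [set p : P | _] = `[- B, B] `*` `[- B, B]).
  by apply: compact_setX; exact: segment_compact.
by apply/seteqP; split => -[x y] /=; rewrite !in_itv /= !ler_norml.
Qed.

(** Adding [k * x.1 ^+ 2] makes the Laplacian strictly positive, which excludes an interior maximum.
    The size [B] of the domain fixes [k] so that the perturbation is at most a quarter of the
    supposed positive value [w p0]. *)
Lemma max_principle D w B : open D -> harmonic_on D w ->
  (forall p, D p -> `|p.1| <= B /\ `|p.2| <= B) ->
  (forall q, closure D q -> ~ D q -> forall e, 0 < e -> exists2 d : R, 0 < d &
     forall x, D x -> `|x.1 - q.1| < d -> `|x.2 - q.2| < d -> w x <= e) ->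
  forall p, D p -> w p <= 0.
Proof.
move=> oD [w1 [w2 hw]] bD bdD p0 Dp0; rewrite leNgt; apply/negP => wp0.
pose k := w p0 / (4 * (B ^+ 2 + 1)).
have B0 : 0 <= B by have [+ _] := bD _ Dp0; apply: le_trans.
have k0 : 0 < k by rewrite divr_gt0 // mulr_gt0 // ltr_wpDl // sqr_ge0.
have kB : k * B ^+ 2 <= w p0 / 4.
  have B2 : 0 < 4 * (B ^+ 2 + 1) by rewrite mulr_gt0 // ltr_wpDl // sqr_ge0.
  have kE : k * (4 * (B ^+ 2 + 1)) = w p0 by rewrite mulfVK // gt_eqF.
  nra.
have k1 x : D x -> k * x.1 ^+ 2 <= w p0 / 4.
  move=> /bD[h _]; apply: le_trans kB; rewrite ler_pM2l //.
  by rewrite -real_normK ?num_real // lerXn2r ?nnegrE.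
pose W x := w x + k * x.1 ^+ 2.
have cW x : D x -> {for x, continuous W}.
  move=> /hw[cw _]; apply: continuousD => //.
  apply: continuousM; first exact: cvg_cst.
  by apply: continuousM; exact: cvg_fst.
pose A := [set x | D x /\ w p0 / 2 <= W x].
have Ap0 : A p0.
  split=> //; rewrite /W; have := sqr_ge0 p0.1; nra.
(* Near a closure point outside [D] one has [w <= w p0 / 8], hence [W <= 3/8 * w p0 < w p0 / 2]: the
   set [A] stays away from the boundary. *)
have cA : compact A.
  apply: subclosed_compact (@compact_box B) _; last by move=> x [/bD].
  rewrite closure_id; apply/seteqP; split; first exact: subset_closure.
  move=> q /closure_boxP qA.
  have [Dq|nDq] := pselect (D q); last first.
    have [||d d0 hd] := bdD q _ nDq (w p0 / 8).
    - by apply/closure_boxP => e /qA[x [Dx _] xe]; exists x.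
    - lra.
    - have [x [Dx Wx] [x1 x2]] := qA _ d0.
      have := hd x Dx x1 x2; have := k1 x Dx; rewrite /W in Wx; lra.
  split=> //; rewrite leNgt; apply/negP => Wq.
  have /cvg_boxP/(_ (w p0 / 2 - W q))[|d d0 hd] := cW q Dq; first lra.
  have [x [Dx Wx] [x1 x2]] := qA _ d0.
  have := hd x x1 x2; rewrite ltr_distl; lra.
have [||c /set_mem[Dc Wc] cmax] := compact_EVT_max (f := W) _ cA.
- by exists p0.
- by apply: continuous_in_subspaceT => x /set_mem[Dx _]; exact: cW.
have {}cmax x : D x -> W x <= W c.
  move=> Dx; have [xA|nxA] := pselect (A x); first by apply: cmax; rewrite inE.
  by apply: le_trans Wc; rewrite leNgt; apply/negP => /ltW ?; apply: nxA.
have [e e0 he] := open_boxP oD Dc.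
have [_ [w11 [w22 [d1 d2 d11 d22 lap]]]] := hw c Dc.
have h1 : w11 + 2 * k <= 0.
  apply: (@second_derivative_max _ (fun t => W (t, c.2))
    (fun t => w1 (t, c.2) + 2 * k * t) c.1 _ e) => //.
  - move=> t te; have [|_ [_ [_ [dw _ _ _ _]]]] := hw (t, c.2).
      by apply: he => //=; rewrite subrr normr0.
    rewrite /W /=; apply: is_derive_eq; rewrite /GRing.scale /=; ring.
  - by apply: is_derive_eq; rewrite /GRing.scale /=; ring.
  - move=> t te; rewrite -surjective_pairing; apply: cmax.
    by apply: he => //=; rewrite subrr normr0.
have h2 : w22 <= 0.
  apply: (@second_derivative_max _ (fun t => W (c.1, t))
    (fun t => w2 (c.1, t)) c.2 _ e) => //.
  - move=> t te; have [|_ [_ [_ [_ dw _ _ _]]]] := hw (c.1, t).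
      by apply: he => //=; rewrite subrr normr0.
    by rewrite /W /=; apply: is_derive_eq; rewrite /GRing.scale /=; ring.
  - move=> t te; rewrite -surjective_pairing; apply: cmax.
    by apply: he => //=; rewrite subrr normr0.
lra.
Qed.

(** The set [v > 0] cuts a bounded piece out of [Om]. On the cut, which is interior, continuity
    makes a pointwise inequality enough; on the original boundary, where the values of [u] carry no
    information, upper limits are compared. *)
Lemma comparison (Om : set P) (u h v : P -> R) B : open Om ->
  harmonic_on Om u -> harmonic_on Om h -> continuous v ->
  (forall p, Om p -> 0 < v p -> `|p.1| <= B /\ `|p.2| <= B) ->
  (forall q, Om q -> v q = 0 -> u q <= h q) ->
  (forall q, bdry Om q -> 0 <= v q -> forall e, 0 < e -> exists2 d : R, 0 < d &
     forall x, Om x -> `|x.1 - q.1| < d -> `|x.2 - q.2| < d -> u x <= h x + e) ->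
  forall p, Om p -> 0 < v p -> u p <= h p.
Proof.
move=> oOm hu hh cv bD lat bd p Omp vp.
pose D := Om `&` [set x | 0 < v x].
have oD : open D.
  apply: openI => //; rewrite (_ : [set x | _] = v @^-1` [set t | 0 < t]) //.
  by apply: open_comp => [x _|]; [exact: cv|exact: open_gt].
have clD q : closure D q -> closure Om q /\ 0 <= v q.
  move=> /closure_boxP hq; split.
    by apply/closure_boxP => e /hq[x [Ox _] xe]; exists x.
  rewrite leNgt; apply/negP => vq.
  have /cvg_boxP/(_ (- v q))[|d /hq[x [Ox /= vx] [x1 x2]] hd] := cv q; first lra.
  by have := hd x x1 x2; rewrite ltr_distl; lra.
have := @max_principle D (fun x => u x - h x) B oD.
rewrite -subr_le0; apply => //.
- by apply: harmonic_sub (harmonicB hu hh) => x [].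
- by move=> x [Ox /= vx]; exact: bD.
- move=> q /clD[cq vq] nDq e e0; have [Oq|nOq] := pselect (Om q); last first.
    have [//|d d0 hd] := bd q _ vq e e0.
    by exists d => // x [Ox _] x1 x2; rewrite lerBlDl; exact: hd.
  have v0 : v q = 0.
    by apply/eqP; rewrite eq_le vq andbT leNgt; apply/negP => ?; apply: nDq.
  have [_ [_ /(_ q Oq)[c _]]] := harmonicB hu hh.
  have /cvg_boxP/(_ e e0)[d d0 hd] := c.
  exists d => // x _ x1 x2; have := hd x x1 x2; have := lat q Oq v0.
  by rewrite ltr_distl; lra.
Qed.

Lemma within_cvg_le (Om : set P) (u h : P -> R) q (l : R) :
  u @ within Om (nbhs q) --> l -> {for q, continuous h} -> l <= h q ->
  forall e, 0 < e -> exists2 d : R, 0 < d & forall x, Om x ->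
    `|x.1 - q.1| < d -> `|x.2 - q.2| < d -> u x <= h x + e.
Proof.
move=> /cvg_within_boxP ul /cvg_boxP ch lh e e0.
have e20 : 0 < e / 2 by lra.
have [d d0 hd] := ul _ e20; have [d' d'0 hd'] := ch _ e20.
exists (Num.min d d') => [|x Ox]; first by rewrite lt_min d0.
rewrite !lt_min => /andP[x1 x1'] /andP[x2 x2'].
have := hd x Ox x1 x2; have := hd' x x1' x2'.
by rewrite !ltr_distl => /andP[? ?] /andP[? ?]; lra.
Qed.

Lemma within_cvg_ge (Om : set P) (u h : P -> R) q (l : R) :
  u @ within Om (nbhs q) --> l -> {for q, continuous h} -> h q <= l ->
  forall e, 0 < e -> exists2 d : R, 0 < d & forall x, Om x ->
    `|x.1 - q.1| < d -> `|x.2 - q.2| < d -> h x <= u x + e.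
Proof.
move=> ul ch hl e e0.
have cN : {for q, continuous (fun x => - h x)} by exact: continuousN.
have ulN : (fun x => - u x) @ within Om (nbhs q) --> - l by exact: cvgN.
have [|d d0 hd] := within_cvg_le ulN cN _ e0; first by rewrite lerN2.
by exists d => // x Ox x1 x2; have := hd x Ox x1 x2; lra.
Qed.

End MaxPrinciple.

(** * Geometry of the domain *)

Section Domain.
Variable R : realType.
Notation P := (R * R)%type.
Implicit Types (p q : P) (D : set P).

Lemma is_derive_d1 (f : P -> R) p : derivable (fun t => f (t, p.2)) p.1 1 ->
  is_derive p.1 1 (fun t => f (t, p.2)) (d1 f p).
Proof. by move=> h; apply: DeriveDef => //; rewrite /d1 derive1E. Qed.

Lemma is_derive_d2 (f : P -> R) p : derivable (fun t => f (p.1, t)) p.2 1 ->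
  is_derive p.2 1 (fun t => f (p.1, t)) (d2 f p).
Proof. by move=> h; apply: DeriveDef => //; rewrite /d2 derive1E. Qed.

(** Replacing [q] by a nearby [q'] of [D] and shifting [p] by [t / (1 - t) * (q - q')] leaves the
    convex combination unchanged, and the shifted [p] remains in [D] by openness. *)
Lemma convex_interior D p q (t : R) : open D -> Defs.convex_set D ->
  D p -> closure D q -> 0 <= t < 1 ->
  D ((1 - t) * p.1 + t * q.1, (1 - t) * p.2 + t * q.2).
Proof.
move=> oD cD Dp /closure_boxP clq /andP[t0 t1].
have [e e0 he] := open_boxP oD Dp.
have s0 : 0 < 1 - t by lra.
have [|q' Dq' [q1 q2]] := clq (e * (1 - t)); first by rewrite mulr_gt0.
pose f (i j k : R) := i + (t / (1 - t)) * (j - k).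
have fE i j k : (1 - t) * f i j k + t * k = (1 - t) * i + t * j.
  by rewrite /f; field; rewrite gt_eqF.
have fp i j k : `|k - j| < e * (1 - t) -> `|f i j k - i| < e.
  move=> jk; rewrite /f addrAC subrr add0r normrM distrC.
  rewrite ger0_norm ?divr_ge0 // ?ltW // mulrAC ltr_pdivrMr //.
  by apply: le_lt_trans jk; rewrite ler_piMl // ltW.
have := cD (f p.1 q.1 q'.1, f p.2 q.2 q'.2) q' t _ Dq'.
rewrite /= !fE; apply; last by rewrite t0 ltW.
by apply: he => /=; exact: fp.
Qed.

(** The graph enters only as a description of the free boundary points in the window; concavity of
    [psi] is deduced from the convexity of [Om]. *)
Definition graph_solution (a : R) (Om : set P) (u : P -> R) (psi : R -> R) : Prop :=
  [/\ 0 < a, fb_solution a Om u &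
      forall p, (Gamma a Om p /\ - a <= p.2 <= a) <->
                (- a <= p.2 <= a /\ p.1 = psi p.2)].

Variables (a : R) (Om : set P) (u : P -> R) (psi : R -> R).
Hypothesis gs : graph_solution a Om u psi.

Let a0 : 0 < a. Proof. by case: gs. Qed.
Let sol : fb_solution a Om u. Proof. by case: gs. Qed.
Let graph : forall p, (Gamma a Om p /\ - a <= p.2 <= a) <->
  (- a <= p.2 <= a /\ p.1 = psi p.2).
Proof. by case: gs. Qed.
Let oOm : open Om. Proof. by case: sol => -[]. Qed.
Let cOm : Defs.convex_set Om. Proof. by case: sol => -[]. Qed.
Let hOm : Om `<=` [set p | 0 <= p.1]. Proof. by case: sol => -[]. Qed.

Lemma open_Om : open Om. Proof. exact: oOm. Qed.

Lemma Om_gt0 (x : P) : Om x -> 0 < x.1.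
Proof.
move=> Ox; have [e e0 he] := open_boxP oOm Ox.
have /hOm /= : Om (x.1 - e / 2, x.2).
  apply: he => /=; last by rewrite subrr normr0.
  by rewrite addrAC subrr add0r normrN gtr0_norm; lra.
lra.
Qed.

Lemma closure_Kseg y : - a <= y <= a -> closure Om (0, y).
Proof.
move=> ya; case: sol => -[_ _ K _] _ _ _ _.
by have [] : bdry Om (0, y) by apply: K.
Qed.

Lemma graph_bdry y : - a <= y <= a -> bdry Om (psi y, y) /\ 0 < psi y.
Proof. by move=> ya; have [|[? []]] := (graph (psi y, y)).2. Qed.

Lemma bdry_graph q : bdry Om q -> - a <= q.2 <= a -> 0 < q.1 -> q.1 = psi q.2.
Proof.
move=> bq qa q0; have [|//] := (graph q).1.
split => //; split => //; split => // -[q10].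
by move: q0; rewrite q10 ltxx.
Qed.

Lemma psi_gt0 y : - a <= y <= a -> 0 < psi y.
Proof. by case/graph_bdry. Qed.

(** If [x] exceeded [psi y], the graph point would lie between an interior point and [(0, y)], hence
    be interior. Conversely, a point between [(0, y)] and the graph point is in the closure, and a
    boundary point with positive abscissa has to be the graph point itself. *)
Lemma Om_graph x y : - a <= y <= a -> Om (x, y) <-> 0 < x < psi y.
Proof.
move=> ya; have [[clp nOp] p0] := graph_bdry ya; have clK := closure_Kseg ya.
split=> [Ox|/andP[x0 xp]].
  have /= x0 := Om_gt0 Ox; rewrite x0 /= ltNge; apply/negP => px.
  apply: nOp; move: px; rewrite le_eqVlt => /orP[/eqP -> //|px].
  have := @convex_interior Om (x, y) (0, y) (1 - psi y / x) oOm cOm Ox clK.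
  rewrite /=.
  have -> : (1 - (1 - psi y / x)) * x + (1 - psi y / x) * 0 = psi y.
    by field; rewrite gt_eqF.
  have -> : (1 - (1 - psi y / x)) * y + (1 - psi y / x) * y = y by ring.
  apply; have : 0 < psi y / x by rewrite divr_gt0.
  have : psi y / x <= 1 by rewrite ler_pdivrMr // mul1r ltW.
  lra.
have t01 : 0 <= x / psi y <= 1.
  by rewrite divr_ge0 ?ler_pdivrMr ?mul1r ?ltW.
have [//|nO] := pselect (Om (x, y)).
suff cl : closure Om (x, y).
  by have /= xE := bdry_graph (conj cl nO) ya x0; rewrite xE ltxx in xp.
apply/closure_boxP => e e0.
move: clp clK => /closure_boxP/(_ e e0)[r Or [r1 r2]].
move=> /closure_boxP/(_ e e0)[s Os [s1 s2]].
exists ((1 - x / psi y) * s.1 + x / psi y * r.1, (1 - x / psi y) * s.2 + x / psi y * r.2).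
  exact: cOm.
have key (i j k l : R) : `|i - k| < e -> `|j - l| < e ->
    `|(1 - x / psi y) * i + x / psi y * j
      - ((1 - x / psi y) * k + x / psi y * l)| < e.
  move: t01 => /andP[]; set t := x / psi y; move=> t0 t1.
  move=> ik jl; have : Num.max `|i - k| `|j - l| < e by rewrite gt_max ik.
  apply: le_lt_trans; set m := Num.max _ _.
  have : `|i - k| <= m by rewrite le_max lexx.
  have : `|j - l| <= m by rewrite le_max lexx orbT.
  rewrite !ler_distl => /andP[? ?] /andP[? ?].
  by apply/andP; split; nra.
split => /=.
  have := key s.1 r.1 0 (psi y); rewrite mulr0 add0r mulfVK ?gt_eqF //.
  by apply.
have := key s.2 r.2 y y; rewrite -mulrDl subrK mul1r.
by apply.
Qed.

(** Graph points are not in [Om], so convexity is applied to points moved inward by [d], with [d]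
    below the arbitrary margin [e]. *)
Lemma psi_concave y z t : - a <= y <= a -> - a <= z <= a -> 0 <= t <= 1 ->
  (1 - t) * psi y + t * psi z <= psi ((1 - t) * y + t * z).
Proof.
move=> ya za t01.
have wa : - a <= (1 - t) * y + t * z <= a.
  by move: ya za t01 => /andP[? ?] /andP[? ?] /andP[? ?]; apply/andP; split; nra.
have py := psi_gt0 ya; have pz := psi_gt0 za.
apply/ler_addgt0Pr => e e0.
have [d [d0 de dy dz _]] := exists_small e0 py pz ltr01.
have Oy : Om (psi y - d, y) by apply/Om_graph => //; lra.
have Oz : Om (psi z - d, z) by apply/Om_graph => //; lra.
have /Om_graph : Om ((1 - t) * (psi y - d) + t * (psi z - d), (1 - t) * y + t * z).
  exact: (@cOm (psi y - d, y) (psi z - d, z)).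
move=> /(_ wa) /andP[_]; move: t01 => /andP[? ?]; nra.
Qed.

Lemma harmonic_u : harmonic_on Om u.
Proof.
case: sol => _ [[C1u [C1d1 C1d2]] _] lap _ _.
exists (d1 u), (d2 u) => p Op; have [[du1 du2] cu _ _] := C1u p Op.
have [[dd1 _] _ _ _] := C1d1 p Op; have [[_ dd2] _ _ _] := C1d2 p Op.
split => //; exists (d1 (d1 u) p), (d2 (d2 u) p); split; last exact: lap.
- exact: is_derive_d1.
- exact: is_derive_d2.
- exact: is_derive_d1.
- exact: is_derive_d2.
Qed.

End Domain.

Lemma is_derive_div (R : realType) (f g : R -> R) (t df dg : R) : g t != 0 ->
  is_derive t 1 f df -> is_derive t 1 g dg ->
  is_derive t 1 (fun s => f s / g s) (df / g t - f t * dg / g t ^+ 2).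
Proof.
move=> g0 Hf Hg; have Hi : is_derive t 1 (fun s => (g s)^-1) (- (g t) ^- 2 *: dg).
  by apply: is_deriveV.
by apply: is_derive_eq; rewrite /GRing.scale /=; field.
Qed.

(** * Logarithmic potentials *)

Section LogPotential.
Variable R : realType.
Notation P := (R * R)%type.
Implicit Types (p q : P) (D : set P).

Definition sqdist (c p : P) : R := (p.1 - c.1) ^+ 2 + (p.2 - c.2) ^+ 2.

Lemma sqdist_ge0 (c p : P) : 0 <= sqdist c p.
Proof. by rewrite addr_ge0 // sqr_ge0. Qed.

Lemma continuous_sqdist c : continuous (sqdist c).
Proof.
move=> p.
have cx : {for p, continuous (fun p : P => p.1 - c.1)}.
  by apply: continuousB; [exact: cvg_fst|exact: cvg_cst].
have cy : {for p, continuous (fun p : P => p.2 - c.2)}.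
  by apply: continuousB; [exact: cvg_snd|exact: cvg_cst].
exact: (continuousD (continuousM cx cx) (continuousM cy cy)).
Qed.

Lemma continuous_subr_sqdist (k : R) c : continuous (fun p => k - sqdist c p).
Proof.
by move=> p; apply: continuousB; [exact: cvg_cst|exact: continuous_sqdist].
Qed.

(** Up to a factor this is the fundamental solution of the plane, written with the squared distance
    so that no square root has to be differentiated. *)
Lemma harmonic_ln_sqdist D c : ~ D c -> harmonic_on D (fun p => ln (sqdist c p)).
Proof.
move=> Dc; exists (fun p => 2 * (p.1 - c.1) / sqdist c p),
  (fun p => 2 * (p.2 - c.2) / sqdist c p) => p Dp.
have N0 : 0 < sqdist c p.
  rewrite lt_neqAle sqdist_ge0 andbT eq_sym paddr_eq0 ?sqr_ge0 //.
  rewrite !sqrf_eq0 !subr_eq0; apply/negP => /andP[/eqP e1 /eqP e2].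
  by apply: Dc; move: Dp; rewrite [p]surjective_pairing e1 e2 -surjective_pairing.
have dN1 : is_derive p.1 1 (fun t => sqdist c (t, p.2)) (2 * (p.1 - c.1)).
  by rewrite /sqdist /=; apply: is_derive_eq; rewrite /GRing.scale /=; ring.
have dN2 : is_derive p.2 1 (fun t => sqdist c (p.1, t)) (2 * (p.2 - c.2)).
  by rewrite /sqdist /=; apply: is_derive_eq; rewrite /GRing.scale /=; ring.
split.
  have cl : {for sqdist c p, continuous (@ln R)} by exact: continuous_ln.
  exact: (continuous_comp (@continuous_sqdist c p) cl).
exists (2 / sqdist c p - 2 * (p.1 - c.1) * (2 * (p.1 - c.1)) / sqdist c p ^+ 2),
  (2 / sqdist c p - 2 * (p.2 - c.2) * (2 * (p.2 - c.2)) / sqdist c p ^+ 2).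
have N0' : sqdist c p != 0 by rewrite gt_eqF.
case: p Dp N0 N0' dN1 dN2 => x y /= Dp N0 N0' dN1 dN2; split.
- have dl := is_derive1_ln N0.
  have := @is_derive1_comp _ (@ln R) (fun t => sqdist c (t, y)) x _ _ dl dN1.
  by move=> h; apply: is_derive_eq; rewrite mulrC.
- have dl := is_derive1_ln N0.
  have := @is_derive1_comp _ (@ln R) (fun t => sqdist c (x, t)) y _ _ dl dN2.
  by move=> h; apply: is_derive_eq; rewrite mulrC.
- apply: (@is_derive_div _ (fun t => 2 * (t - c.1)) (fun t => sqdist c (t, y))) => //.
  by apply: is_derive_eq; rewrite /GRing.scale /=; ring.
- apply: (@is_derive_div _ (fun t => 2 * (t - c.2)) (fun t => sqdist c (x, t))) => //.
  by apply: is_derive_eq; rewrite /GRing.scale /=; ring.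
- move: N0'; rewrite /sqdist /= => N0'; field; exact: N0'.
Qed.

End LogPotential.

(** * Global bounds on the solution *)

Section Bounds.
Variable R : realType.
Notation P := (R * R)%type.
Implicit Types (p q : P).
Variables (a : R) (Om : set P) (u : P -> R) (psi : R -> R).
Hypothesis gs : graph_solution a Om u psi.

(* The corners [(0, a)] and [(0, - a)], where nothing is assumed on [w], are
   removed by adding a small multiple of a positive harmonic function which
   blows up there and at infinity. *)
Lemma max_principle_corners (w : P -> R) (c M : R) : harmonic_on Om w ->
  (forall p, Om p -> `|w p| <= M) ->
  (forall q, bdry Om q -> q <> (0, a) -> q <> (0, - a) ->
     exists2 l, l <= c & w @ within Om (nbhs q) --> l) ->
  forall p, Om p -> w p <= c.
Proof.
move=> hw wM bw p Op.
(* The pole [q0] is at distance at least 1 from [Om], so its logarithm is nonnegative there. Two of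
   its three copies in [v], together with [ln K], absorb the logarithms of the corner poles; the
   third makes [v] grow at infinity. *)
pose q0 : P := (-1, 0); pose qp : P := (0, a); pose qm : P := (0, - a).
pose K := 2 * (1 + a ^+ 2); pose v p := 2 * ln K + 3 * ln (sqdist q0 p)
  - ln (sqdist qp p) - ln (sqdist qm p).
have a20 : 0 <= a ^+ 2 by exact: sqr_ge0.
have K0 : 0 < K by rewrite /K; lra.
have Nq x : Om x -> 1 <= sqdist q0 x.
  move=> /(Om_gt0 gs) x0; rewrite /sqdist /q0 /= opprK subr0; nra.
have Npm x s : Om x -> s ^+ 2 = a ^+ 2 ->
    0 < sqdist (0, s) x /\ sqdist (0, s) x <= K * sqdist q0 x.
  move=> Ox s2; have x0 := Om_gt0 gs Ox; have := Nq x Ox.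
  rewrite /sqdist /q0 /= opprK !subr0 => N1; split.
    by rewrite ltr_pwDl // ?sqr_ge0 // exprn_gt0.
  have h1 : (x.2 - s) ^+ 2 <= 2 * (x.2 ^+ 2 + a ^+ 2).
    by rewrite -s2; have := sqr_ge0 (x.2 + s); nra.
  have h2 : x.1 ^+ 2 <= (x.1 + 1) ^+ 2 by nra.
  have h3 : a ^+ 2 * 1 <= a ^+ 2 * ((x.1 + 1) ^+ 2 + x.2 ^+ 2) by rewrite ler_wpM2l.
  rewrite /K; nra.
have lnq x s : Om x -> s ^+ 2 = a ^+ 2 -> ln (sqdist (0, s) x) <= ln K + ln (sqdist q0 x).
  move=> Ox /(Npm x s Ox)[s0 sK]; have N1 := Nq x Ox.
  rewrite -lnM ?posrE //; last lra.
  by rewrite ler_ln ?posrE // mulr_gt0 //; lra.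
have lnq0 x : Om x -> 0 <= ln (sqdist q0 x) by move=> /Nq; exact: ln_ge0.
have v0 x : Om x -> [/\ 0 <= v x, ln (sqdist q0 x) <= v x, - ln (sqdist qp x) <= v x
    & - ln (sqdist qm x) <= v x].
  move=> Ox; have := lnq0 x Ox; have := lnq x a Ox erefl.
  have := lnq x (- a) Ox (sqrrN a); rewrite /v /qp /qm; move=> h1 h2 h3.
  have : 0 <= ln K by apply: ln_ge0; rewrite /K; lra.
  by split; lra.
have hv : harmonic_on Om v.
  have nO s : ~ Om (0, s) by move/(Om_gt0 gs); rewrite /= ltxx.
  have nq : ~ Om q0 by move/(Om_gt0 gs); rewrite /=; lra.
  rewrite /v; apply: harmonicB; last exact: harmonic_ln_sqdist (nO _).
  apply: harmonicB; last exact: harmonic_ln_sqdist (nO _).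
  apply: harmonicD; last exact: harmonicZ (harmonic_ln_sqdist nq).
  exact: harmonic_cst.
have M0 : 0 <= M by apply: le_trans (wM p Op).
have key e : 0 < e -> w p <= c + e * v p.
  (* Where [v >= T], the bound [w <= M] already gives [w <= c + e * v]. It remains to find [v >= T]
     on a large circle and near both corners. *)
  move=> e0; pose T := (M + `|c|) / e.
  have T0 : 0 <= T by rewrite divr_ge0 ?addr_ge0 // ltW.
  have eT : e * T = M + `|c| by rewrite /T mulrC divfK // gt_eqF.
  pose r := expR T + 1 + sqdist 0 p.
  have N0 := sqdist_ge0 0 p; have e1 := @expR_gt0 R T.
  have cc := ler_norm (- c); rewrite normrN in cc.
  pose V x := r ^+ 2 - sqdist 0 x.
  have vT x : Om x -> T <= v x -> w x <= c + e * v x.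
    move=> Ox Tv; have := wM x Ox; have := ler_norm (w x).
    have : e * T <= e * v x by rewrite ler_pM2l.
    by lra.
  apply: (@comparison R Om w (fun x => c + e * v x) V r) => //.
  - exact: open_Om gs.
  - by apply: harmonicD; [exact: harmonic_cst|exact: harmonicZ].
  - exact: continuous_subr_sqdist.
  - move=> x _; rewrite /V /sqdist /= !subr0 => h; have r0 : 0 <= r by rewrite /r; lra.
    have h1 := sqr_ge0 x.1; have h2 := sqr_ge0 x.2.
    split; rewrite -(@ler_pXn2r _ 2) ?nnegrE ?normr_ge0 // real_normK ?num_real //; lra.
  - move=> x Ox /eqP; rewrite subr_eq0 => /eqP r2; apply: vT => //.
    have [_ + _ _] := v0 x Ox; apply: le_trans.
    rewrite -[T]expRK ler_ln ?posrE //; last by have := Nq x Ox; lra.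
    have x0 := Om_gt0 gs Ox.
    apply: (@le_trans _ _ (r ^+ 2)); first by rewrite /r; nra.
    by rewrite r2 /sqdist /q0 /= opprK !subr0; nra.
  - have corner q s : s = a \/ s = - a -> q = (0, s) ->
      forall k, 0 < k -> exists2 d : R, 0 < d &
      forall x, Om x -> `|x.1 - q.1| < d -> `|x.2 - q.2| < d -> w x <= c + e * v x + k.
      move=> sa -> k k0; pose E := expR (- T).
      have E0 : 0 < E by exact: expR_gt0.
      have E1 : E <= 1 by rewrite /E -expR0 ler_expR oppr_le0.
      (* In this box the squared distance to the corner is at most [E], because [E <= 1]; minus its
         logarithm is then at least [T]. *)
      exists (E / 2) => [|x Ox /= x1 x2]; first by lra.
      apply: le_trans (_ : c + e * v x <= _); last by rewrite lerDl ltW.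
      apply: vT => //; apply: (@le_trans _ _ (- ln (sqdist (0, s) x))).
        have [] := Npm x s Ox; first by case: sa => -> //; exact: sqrrN.
        move=> s0 _; rewrite lerNr -[leRHS]expRK ler_ln ?posrE //.
        rewrite -/E /sqdist /=; move: x1 x2; rewrite !ltr_distl.
        by move=> /andP[? ?] /andP[? ?]; nra.
      by case: sa => ->; have [] := v0 x Ox.
    move=> q bq _ k k0.
    have [qa|qa] := pselect (q = (0, a)); first by apply: corner qa _ k0; left.
    have [qb|qb] := pselect (q = (0, - a)); first by apply: corner qb _ k0; right.
    have [l lc /cvg_within_boxP/(_ k k0)[d d0 hd]] := bw q bq qa qb.
    exists d => // x Ox x1 x2; have := hd x Ox x1 x2; rewrite ltr_distl.
    have [vx _ _ _] := v0 x Ox.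
    have : 0 <= e * v x by rewrite mulr_ge0 // ltW.
    by lra.
  - rewrite /V /r; nra.
have [vp _ _ _] := v0 p Op.
(* The bound [key] is used with an [e] so small that [e * v p] is less than half of the gap
   [w p - c]. *)
rewrite leNgt; apply/negP => wc.
have v1 : 0 < v p + 1 by lra.
have /key : 0 < (w p - c) / 2 / (v p + 1) by rewrite !divr_gt0 //; lra.
have : (w p - c) / 2 / (v p + 1) * (v p + 1) = (w p - c) / 2 by rewrite divfK // gt_eqF.
have : 0 < (w p - c) / 2 / (v p + 1) by rewrite !divr_gt0 //; lra.
nra.
Qed.

Lemma u_bounds p : Om p -> 0 <= u p <= 1.
Proof.
move=> Op; have hu := harmonic_u gs.
case: (gs) => a0 [_ [_ [M uM]] _ [uK u0] _] _.
have lim q : bdry Om q -> q <> (0, a) -> q <> (0, - a) ->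
    exists2 l : R, 0 <= l <= 1 & u @ within Om (nbhs q) --> l.
  case: q => x y bq qa qb; have [Kq|nKq] := pselect (Kseg a (x, y)); last first.
    by exists 0; [rewrite lexx ler01|exact: u0].
  exists 1; first by rewrite ler01 lexx.
  apply: uK => //; case: Kq => /= x0 /andP[y1 y2]; rewrite !lt_neqAle y1 y2 !andbT.
  by apply/andP; split; apply/eqP => ya; [apply: qb|apply: qa]; rewrite x0 ya.
apply/andP; split.
  rewrite -oppr_le0; apply: (@max_principle_corners (fun x => - u x) 0 M) => //.
  - by apply: harmonic_ext (harmonicZ (-1) hu) => x; rewrite mulN1r.
  - by move=> x /uM; rewrite normrN.
  - move=> q bq qa qb; have [l /andP[l0 _] hl] := lim q bq qa qb.
    by exists (- l); [rewrite oppr_le0|exact: cvgN].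
apply: (@max_principle_corners u 1 M) => //.
by move=> q bq qa qb; have [l /andP[_ l1] hl] := lim q bq qa qb; exists l.
Qed.

End Bounds.

(** * Behaviour at the free boundary *)

Section BoundaryGradient.
Variable R : realType.
Notation P := (R * R)%type.
Implicit Types (p q : P).

Lemma MVT_dist (f df : R -> R) (x y l e : R) : x <= y ->
  (forall t, x <= t <= y -> is_derive t 1 f (df t) /\ `|df t - l| <= e) ->
  `|f y - f x - l * (y - x)| <= e * (y - x).
Proof.
move=> xy H; have [||c] := @MVT_segment R f df x y xy.
- move=> t; rewrite in_itv /= => /andP[x1 x2].
  by have [|] := H t; first by rewrite !ltW.
- apply: derivable_within_continuous => t; rewrite in_itv /= => xty.
  by have [[]] := H t xty.
rewrite in_itv /= => /H[_ dc] ->.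
by rewrite -mulrBl normrM (@ger0_norm _ (y - x)) ?subr_ge0 // ler_wpM2r ?subr_ge0.
Qed.

Variables (a : R) (Om : set P) (u : P -> R) (psi : R -> R).
Hypothesis gs : graph_solution a Om u psi.

(** The graph lies above the chord from [y0] to the endpoint of [[-a, a]] on the side of [y]. The
    positive value of [psi] at that endpoint is dropped, and the distance from [y0] to it is
    replaced by the distance to the nearer endpoint. *)
Lemma psi_cone y0 y : - a < y0 < a -> - a <= y <= a ->
  psi y0 * (1 - `|y - y0| / (a - `|y0|)) <= psi y.
Proof.
move=> ya0 ya.
have ya0' : - a <= y0 <= a by move: ya0 => /andP[? ?]; apply/andP; lra.
have p0 := psi_gt0 gs ya0'.
have A0 : 0 < a - `|y0| by rewrite subr_gt0 ltr_norml.
have [yl|yl] := leP y0 y.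
  have d0 : 0 < a - y0 by lra.
  have y0n := ler_norm y0.
  pose t := (y - y0) / (a - y0).
  have t01 : 0 <= t <= 1.
    by apply/andP; split; [apply: divr_ge0; lra|rewrite ler_pdivrMr //; lra].
  have tE : (1 - t) * y0 + t * a = y by rewrite /t; field; rewrite gt_eqF.
  have aa : - a <= a <= a by case: (gs); lra.
  have := psi_concave gs ya0' aa t01; rewrite tE; apply: le_trans.
  have pa := psi_gt0 gs aa.
  rewrite (ger0_norm (_ : 0 <= y - y0)) ?subr_ge0 //.
  have tt : t <= (y - y0) / (a - `|y0|).
    by rewrite /t ler_wpM2l ?subr_ge0 // lef_pV2 ?posrE //; lra.
  by move: t01 => /andP[t0 _]; have := ler_wpM2l (ltW p0) tt;
    have := mulr_ge0 t0 (ltW pa); lra.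
have d0 : 0 < a + y0 by lra.
have y0n := ler_norm (- y0); rewrite normrN in y0n.
pose t := (y0 - y) / (a + y0).
have t01 : 0 <= t <= 1.
  by apply/andP; split; [apply: divr_ge0; lra|rewrite ler_pdivrMr //; lra].
have tE : (1 - t) * y0 + t * (- a) = y by rewrite /t; field; rewrite gt_eqF.
have aa : - a <= - a <= a by case: (gs); lra.
have := psi_concave gs ya0' aa t01; rewrite tE; apply: le_trans.
have pa := psi_gt0 gs aa.
rewrite distrC (gtr0_norm (_ : 0 < y0 - y)) ?subr_gt0 //.
have tt : t <= (y0 - y) / (a - `|y0|).
  by apply: ler_wpM2l; [lra|rewrite lef_pV2 ?posrE //; lra].
by move: t01 => /andP[t0 _]; have := ler_wpM2l (ltW p0) tt;
  have := mulr_ge0 t0 (ltW pa); lra.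
Qed.

Lemma is_derive_u p : Om p ->
  is_derive p.1 1 (fun t => u (t, p.2)) (d1 u p) /\
  is_derive p.2 1 (fun t => u (p.1, t)) (d2 u p).
Proof.
case: (gs) => _ [_ [[C1u _] _] _ _ _] _ /C1u[[du1 du2] _ _ _].
by split; [exact: is_derive_d1|exact: is_derive_d2].
Qed.

Lemma u_bdry q : bdry Om q -> 0 < q.1 -> u @ within Om (nbhs q) --> (0 : R).
Proof.
move=> bq q0; case: (gs) => _ [_ _ _ [_ u0] _] _.
by apply: u0 => // -[q10]; rewrite q10 ltxx in q0.
Qed.

(* In the last clause the directions [(-1, s)] and [(-1, - s)] point into [Om],
   where [u >= 0]. *)
Lemma boundary_gradient y0 : - a < y0 < a -> exists g1 g2 : R,
  [/\ g1 ^+ 2 + g2 ^+ 2 = 1,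
      forall e, 0 < e -> exists2 d : R, 0 < d & forall t, 0 < t < d ->
        `|u (psi y0 - t, y0) + g1 * t| <= e * t &
      forall s, 0 <= s -> s * psi y0 < a - `|y0| -> s * `|g2| <= - g1].
Proof.
move=> ya0; have ya0' : - a <= y0 <= a by move: ya0 => /andP[? ?]; apply/andP; lra.
have p0 := psi_gt0 gs ya0'; have [bp _] := graph_bdry gs ya0'.
have A0 : 0 < a - `|y0| by rewrite subr_gt0 ltr_norml.
have [_ sol _] := gs; case: sol => _ _ _ _ gG.
have [|g1 [g2 [/cvg_within_boxP l1 /cvg_within_boxP l2 g12]]] := gG (psi y0, y0).
  by split => //; split => // -[/= h]; rewrite h ltxx in p0.
have g1n : `|g1| <= 1.
  by rewrite -(@ler_pXn2r _ 2) ?nnegrE // expr1n real_normK ?num_real // -g12 lerDl sqr_ge0.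
(* The mean value theorem is applied between [psi y0 - t] and [psi y0 - s], where [d1 u] is within
   [e] of [g1]; then [s] is made small, where [u] is close to its boundary value 0. *)
have hA e : 0 < e -> exists2 d : R, 0 < d & forall t, 0 < t < d ->
        `|u (psi y0 - t, y0) + g1 * t| <= e * t.
  clear g12 A0; move=> e0; have [d d0 hd] := l1 e e0.
  exists (Num.min d (psi y0)) => [|t]; first by rewrite lt_min d0.
  rewrite lt_min => /andP[t0 /andP[td tp]].
  apply/ler_addgt0Pr => k k0.
  have /cvg_within_boxP/(_ (k / 2))[|c c0 hc] := u_bdry bp p0; first lra.
  have k20 : 0 < k / 2 by rewrite divr_gt0.
  have [s [s0 sc sk st _]] := exists_small c0 k20 t0 ltr01.
  have H := @MVT_dist (fun x => u (x, y0)) (fun x => d1 u (x, y0))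
     (psi y0 - t) (psi y0 - s) g1 e.
  have {}H : `|u (psi y0 - s, y0) - u (psi y0 - t, y0) - g1 * (t - s)| <= e * (t - s).
    have -> : t - s = psi y0 - s - (psi y0 - t) by ring.
    apply: H => [|x /andP[x1 x2]]; first lra.
    have Ox : Om (x, y0) by apply/(Om_graph gs) => //; lra.
    split; first by have [] := is_derive_u Ox.
    apply/ltW/hd => //=; last by rewrite subrr normr0.
    by rewrite ltr_distl; lra.
  have Os : Om (psi y0 - s, y0) by apply/(Om_graph gs) => //; lra.
  have := hc _ Os; rewrite /= subrr normr0 => /(_ _ c0).
  rewrite (_ : psi y0 - s - psi y0 = - s); last by ring.
  rewrite normrN gtr0_norm // => /(_ sc); rewrite subr0.
  have : `|g1 * s| <= s by rewrite normrM (gtr0_norm s0) ler_piMl // ltW.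
  move: sk H; have : 0 < e * s by rewrite mulr_gt0.
  clear - gs; rewrite !ler_norml !ltr_norml => ? ? /andP[? ?] /andP[? ?] /andP[? ?].
  by apply/andP; split; lra.
exists g1, g2; split => // s s0 sP.
suff main g : `|g| <= s -> 0 <= - g1 + g * g2.
  have [g20|g20] := leP 0 g2.
    by rewrite ger0_norm //; have := main (- s);
      rewrite normrN ger0_norm // => /(_ (lexx _)); lra.
  by rewrite ltr0_norm //; have := main s; rewrite ger0_norm // => /(_ (lexx _)); lra.
clear g12 g1n; move=> gs'; apply/ler_addgt0Pr => k k0; rewrite [X in _ <= X]addrC -lerBlDl sub0r.
(* The horizontal displacement costs an error [e * t] and the vertical one [e * s * t], in total
   [k * t]. *)
pose e := k / (1 + s).
have e0 : 0 < e by rewrite divr_gt0 //; lra.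
have eE : e * (1 + s) = k by rewrite /e divfK // gt_eqF //; lra.
have [d d0 hd] := hA e e0; have [c c0 hc] := l2 e e0.
have s1 : 0 < s + 1 by rewrite ltr_wpDl.
have cs0 : 0 < c / (s + 1) by rewrite divr_gt0.
have [t [t0 td tc tP tcs]] := exists_small d0 c0 p0 cs0.
have stc : s * t < c.
  have : t * (s + 1) < c by rewrite -ltr_pdivlMr //; lra.
  by lra.
(* The cone of opening [s] at the graph point stays in [Om] by [psi_cone]; this is the purpose of
   [s * psi y0 < a - |y0|]. *)
have O y : `|y - y0| <= s * t -> Om (psi y0 - t, y).
  move=> yd; have sA : s * t < a - `|y0|.
    apply: le_lt_trans sP; rewrite ler_wpM2l //; exact: ltW.
  have yn : `|y| <= a.
    have : `|y| <= `|y - y0| + `|y0| by rewrite -{1}(subrK y0 y) ler_normD.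
    lra.
  rewrite ler_norml in yn.
  apply/(Om_graph gs) => //; apply/andP; split; first lra.
  have := psi_cone ya0 yn; apply: lt_le_trans.
  rewrite mulrBr mulr1 ltrD2l ltrN2 mulrA ltr_pdivrMr // mulrC.
  apply: (@le_lt_trans _ _ (s * t * psi y0)); first by rewrite ler_wpM2r // ltW.
  by rewrite mulrAC [t * _]mulrC ltr_pM2r.
have Og : Om (psi y0 - t, y0 + g * t).
  apply: O; rewrite addrAC subrr add0r normrM (gtr0_norm t0).
  by apply: ler_wpM2r => //; exact: ltW.
have /andP[u0 _] := u_bounds gs Og.
have t0d : 0 < t < d by rewrite t0.
clear ya0 ya0' A0 sP cs0 tcs tP s1 c0 d0 p0.
have := hd t t0d.
have dO y : `|y - y0| <= s * t ->
    is_derive y 1 (fun x => u (psi y0 - t, x)) (d2 u (psi y0 - t, y))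
    /\ `|d2 u (psi y0 - t, y) - g2| <= e.
  move=> yd; have Oy := O y yd; split; first by have [] := is_derive_u Oy.
  apply/ltW/hc => //=; last exact: le_lt_trans stc.
  by rewrite addrAC subrr add0r normrN gtr0_norm.
have H : `|u (psi y0 - t, y0 + g * t) - u (psi y0 - t, y0) - g2 * (g * t)| <= e * (s * t).
  have gst : `|g| * t <= s * t by rewrite ler_wpM2r // ltW.
  have [g0|g0] := leP 0 g.
    rewrite (ger0_norm g0) in gst.
    have gt0 : 0 <= g * t by rewrite mulr_ge0 // ltW.
    have yE : y0 + g * t - y0 = g * t by ring.
    apply: (@le_trans _ _ (e * (g * t))); last by rewrite ler_wpM2l // ltW.
    have := @MVT_dist (fun x => u (psi y0 - t, x))
      (fun x => d2 u (psi y0 - t, x)) y0 (y0 + g * t) g2 e.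
    rewrite yE; apply => [|y /andP[? ?]]; first by rewrite lerDl.
    by apply: dO; rewrite ler_distl; lra.
  rewrite (ltr0_norm g0) in gst.
  have gt0 : g * t <= 0 by rewrite mulr_le0_ge0 // ltW.
  have yE : y0 - (y0 + g * t) = - (g * t) by ring.
  have h : `|u (psi y0 - t, y0) - u (psi y0 - t, y0 + g * t)
      - g2 * (y0 - (y0 + g * t))| <= e * (s * t).
    apply: (@le_trans _ _ (e * (- (g * t)))); last by rewrite (ler_pM2l e0); lra.
    have := @MVT_dist (fun x => u (psi y0 - t, x))
      (fun x => d2 u (psi y0 - t, x)) (y0 + g * t) y0 g2 e.
    rewrite yE; apply => [|y /andP[? ?]]; first by rewrite gerDl.
    by apply: dO; rewrite ler_distl; lra.
  rewrite -normrN; apply: le_trans h; rewrite le_eqVlt; apply/orP; left; apply/eqP.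
  by congr `|_|; ring.
move: u0 H; clear - gs t0 eE; rewrite !ler_norml => ? /andP[? ?] /andP[? ?].
by rewrite -(ler_pM2r t0) -eE; lra.
Qed.

End BoundaryGradient.

(** * Supporting lines and the disk barrier *)

Section Barrier.
Variable R : realType.
Notation P := (R * R)%type.
Implicit Types (p q : P).
Variables (a : R) (Om : set P) (u : P -> R) (psi : R -> R).
Hypothesis gs : graph_solution a Om u psi.

(** The supremum of the chord slopes to the right of [y0] works, since by concavity every chord
    slope to the left bounds them all. *)
Lemma supporting_slope y0 : - a < y0 < a -> exists m : R,
  forall y, - a <= y <= a -> psi y <= psi y0 + m * (y - y0).
Proof.
move=> /andP[y0l y0r].
have slope y z : - a <= y -> y < y0 -> y0 < z -> z <= a ->
    (psi z - psi y0) / (z - y0) <= (psi y0 - psi y) / (y0 - y).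
  move=> ay yy0 y0z za; rewrite ler_pdivrMr ?subr_gt0 // mulrAC ler_pdivlMr ?subr_gt0 //.
  have ya : - a <= y <= a by lra.
  have za' : - a <= z <= a by lra.
  pose t := (y0 - y) / (z - y).
  have zy : 0 < z - y by lra.
  have t01 : 0 <= t <= 1.
    by apply/andP; split; [apply: divr_ge0; lra|rewrite ler_pdivrMr //; lra].
  have tE : t * (z - y) = y0 - y by rewrite /t divfK // gt_eqF.
  have := psi_concave gs ya za' t01.
  rewrite (_ : (1 - t) * y + t * z = y0); last by rewrite -[LHS]/((1 - t) * y + t * z); lra.
  rewrite -(ler_pM2l zy).
  have -> : (z - y) * ((1 - t) * psi y + t * psi z) =
    (z - y - t * (z - y)) * psi y + t * (z - y) * psi z by ring.
  rewrite tE; lra.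
pose S := [set (psi z - psi y0) / (z - y0) | z in [set z | y0 < z <= a]].
have S0 : S !=set0 by exists ((psi a - psi y0) / (a - y0)), a => //=; rewrite y0r lexx.
have ubS y : - a <= y -> y < y0 -> ubound S ((psi y0 - psi y) / (y0 - y)).
  by move=> ay yy0 _ [z /= /andP[? ?] <-]; exact: slope.
have hS : has_sup S.
  by split => //; exists ((psi y0 - psi (- a)) / (y0 - - a)); apply: ubS.
exists (sup S) => y /andP[ay ya].
have [yy0|y0y|->] := ltgtP y y0; last by rewrite subrr mulr0 addr0.
  have := ge_sup S0 (ubS y ay yy0).
  by rewrite ler_pdivlMr ?subr_gt0 //; lra.
have : (psi y - psi y0) / (y - y0) <= sup S.
  by apply: ub_le_sup; [case: hS|exists y => //=; rewrite y0y].
by rewrite ler_pdivrMr ?subr_gt0 //; lra.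
Qed.

(** Convexity carries the local bound on [psi] over to all of [Om]: from a point beyond the line,
    the segment towards the graph point stays in [Om] and beyond the line, and for the chosen [d] it
    has reached an ordinate in [[-a, a]]. *)
Lemma supporting_line y0 m : - a < y0 < a ->
  (forall y, - a <= y <= a -> psi y <= psi y0 + m * (y - y0)) ->
  forall q, closure Om q -> 0 <= psi y0 - q.1 + m * (q.2 - y0).
Proof.
move=> ya0 hm; have ya0' : - a <= y0 <= a by lra.
have A0 : 0 < a - `|y0| by rewrite subr_gt0 ltr_norml.
have inOm p : Om p -> 0 <= psi y0 - p.1 + m * (p.2 - y0).
  move=> Op; rewrite leNgt; apply/negP => neg.
  pose d := (a - `|y0|) / (a - `|y0| + `|p.2 - y0|).
  have n0 := normr_ge0 (p.2 - y0).
  have d0 : 0 < d by apply: divr_gt0; lra.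
  have d1 : d <= 1 by rewrite ler_pdivrMr; lra.
  have dE : d * (a - `|y0| + `|p.2 - y0|) = a - `|y0| by rewrite divfK // gt_eqF //; lra.
  have [[clp _] _] := graph_bdry gs ya0'.
  have oO : open Om := open_Om gs.
  have cO : Defs.convex_set Om by case: (gs) => _ [[]].
  have t01 : 0 <= 1 - d < 1 by lra.
  have := convex_interior oO cO Op clp t01.
  rewrite /= (_ : 1 - (1 - d) = d); last by ring.
  set z1 := d * p.1 + _; set z2 := d * p.2 + _ => Oz.
  have z2E : z2 = y0 + d * (p.2 - y0) by rewrite /z2; ring.
  have za : `|z2| <= a.
    rewrite z2E; apply: le_trans (ler_normD _ _) _.
    rewrite normrM (gtr0_norm d0).
    have : 0 <= d * (a - `|y0|) by rewrite mulr_ge0 // ltW.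
    by move: dE; rewrite mulrDr; lra.
  rewrite ler_norml in za.
  have /andP[_ zz] := (Om_graph gs _ za).1 Oz.
  have := hm _ za; rewrite z2E => hz.
  have : psi y0 - z1 + m * (z2 - y0) = d * (psi y0 - p.1 + m * (p.2 - y0)).
    by rewrite /z1 /z2; ring.
  have : d * (psi y0 - p.1 + m * (p.2 - y0)) < 0 by rewrite pmulr_rlt0.
  by rewrite z2E in zz *; lra.
move=> q /closure_boxP clq; rewrite leNgt; apply/negP => neg.
set f := psi y0 - q.1 + m * (q.2 - y0) in neg.
pose e := - f / (1 + `|m|).
have m0 := normr_ge0 m.
have e0 : 0 < e by apply: divr_gt0; lra.
have eE : e * (1 + `|m|) = - f by rewrite divfK // gt_eqF //; lra.
have [p Op [p1 p2]] := clq e e0; have := inOm p Op.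
have : `|m * (p.2 - q.2)| <= `|m| * e by rewrite normrM ler_wpM2l // ltW.
move: p1; rewrite ltr_distl ler_norml /f in eE * => /andP[? ?] /andP[? ?].
by lra.
Qed.

(** Since [k] is the length of the normal [(-1, m)], [S] is the distance to the supporting line and
    [T] the coordinate along it. With [s = S / r] in [[0, 1]], the barrier is [1 + 2 s (1 - s) >= 1]
    on the circle and [(T / r)^2 + s (2 - s) >= 0] at boundary points in the disk. The condition
    [r < psi y0] keeps the disk off [K_a]. *)
Lemma barrier y0 r : - a < y0 < a -> 0 < r < psi y0 -> exists m k : R,
  [/\ k ^+ 2 = 1 + m ^+ 2, 0 < k & forall p, Om p -> sqdist (psi y0, y0) p < r ^+ 2 ->
  u p <= (((p.2 - y0 + m * (p.1 - psi y0)) / k) ^+ 2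
          - ((m * (p.2 - y0) - (p.1 - psi y0)) / k) ^+ 2) / r ^+ 2
         + 2 * ((m * (p.2 - y0) - (p.1 - psi y0)) / k) / r].
Proof.
move=> ya0 /andP[r0 rp]; have [m /(supporting_line ya0) sup] := supporting_slope ya0.
pose k := Num.sqrt (1 + m ^+ 2).
have m2 := sqr_ge0 m.
have k2 : k ^+ 2 = 1 + m ^+ 2 by rewrite sqr_sqrtr //; lra.
have k0 : 0 < k by rewrite sqrtr_gt0; lra.
exists m, k; split => // p Op vp.
pose S (x : P) := (m * (x.2 - y0) - (x.1 - psi y0)) / k.
pose T (x : P) := (x.2 - y0 + m * (x.1 - psi y0)) / k.
pose h x := (T x ^+ 2 - S x ^+ 2) / r ^+ 2 + 2 * S x / r.
have hh D : harmonic_on D h.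
  apply: harmonic_ext (@harmonic_quadratic_at R D 0 (- (2 / (k * r))) (2 * m / (k * r))
    ((m ^+ 2 - 1) / (k ^+ 2 * r ^+ 2)) (4 * m / (k ^+ 2 * r ^+ 2)) (psi y0) y0) => x.
  by rewrite /h /S /T; field; rewrite !gt_eqF.
have ST x : S x ^+ 2 + T x ^+ 2 = sqdist (psi y0, y0) x.
  have -> : S x ^+ 2 + T x ^+ 2 = sqdist (psi y0, y0) x * (1 + m ^+ 2) / k ^+ 2.
    by rewrite /S /T /sqdist /=; field; rewrite gt_eqF.
  by rewrite -k2 mulfK // gt_eqF // exprn_gt0.
have S0 x : closure Om x -> 0 <= S x.
  by move=> /sup h0; apply: divr_ge0; [lra|exact: ltW].
have Sr x : closure Om x -> sqdist (psi y0, y0) x <= r ^+ 2 -> 0 <= S x / r <= 1.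
  move=> clx vx; rewrite ler_pdivrMr // mul1r divr_ge0 ?S0 ?(ltW r0) //=.
  have := S0 x clx; have := ST x; have := sqr_ge0 (T x) => ? ? ?.
  by rewrite -(@ler_pXn2r _ 2) ?nnegrE //; [lra|exact: ltW].
have hE x : h x = (T x / r) ^+ 2 - (S x / r) ^+ 2 + 2 * (S x / r).
  by rewrite /h; field; rewrite gt_eqF.
pose V (x : P) := r ^+ 2 - sqdist (psi y0, y0) x.
have Vr x : 0 <= V x -> `|x.1 - psi y0| <= r /\ `|x.2 - y0| <= r.
  rewrite /V /sqdist /= => Vx.
  have := sqr_ge0 (x.1 - psi y0); have := sqr_ge0 (x.2 - y0) => ? ?.
  by split; rewrite -(@ler_pXn2r _ 2) ?nnegrE ?normr_ge0 ?(ltW r0) // real_normK ?num_real //; lra.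
apply: (@comparison R Om u h V (psi y0 + r + `|y0|) (open_Om gs) (harmonic_u gs) (hh _)) => //.
- exact: continuous_subr_sqdist.
- move=> x _ /ltW /Vr[]; rewrite !ler_distl => /andP[? ?] /andP[? ?].
  have := ler_norm y0; have := ler_norm (- y0); rewrite normrN => ? ?.
  by have := normr_ge0 y0; rewrite !ler_norml; split; lra.
- move=> q Oq /eqP; rewrite subr_eq0 => /eqP rq.
  have /andP[_ u1] := u_bounds gs Oq; apply: le_trans u1 _.
  have clq : closure Om q by exact: subset_closure.
  have /andP[s0 s1] : 0 <= S q / r <= 1 by apply: Sr => //; rewrite rq.
  have : (T q / r) ^+ 2 + (S q / r) ^+ 2 = 1.
    have -> : (T q / r) ^+ 2 + (S q / r) ^+ 2 = (S q ^+ 2 + T q ^+ 2) / r ^+ 2.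
      by move: (T q) (S q) => x y; field; rewrite gt_eqF.
    by rewrite ST -rq divff // gt_eqF // exprn_gt0.
  rewrite hE; nra.
- move=> q bq Vq; have [q1 _] := Vr q Vq.
  have qp : 0 < q.1 by move: q1; rewrite ler_distl; lra.
  apply: within_cvg_le (u_bdry gs bq qp) _ _.
    exact: harmonic_continuous (hh setT) I.
  have /andP[s0 s1] : 0 <= S q / r <= 1 by apply: Sr; [case: bq|rewrite /V in Vq; lra].
  rewrite hE; have := sqr_ge0 (T q / r); nra.
- by rewrite /V; lra.
Qed.

End Barrier.

(** * A uniform bound and a Lipschitz estimate for the graph *)

Section Slope.
Variable R : realType.
Notation P := (R * R)%type.
Implicit Types (p q : P).

(** Turns a barrier into a gradient bound: [- g] is the inward slope of [f] at the contact point,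
    [c] that of the barrier, and [K] takes the quadratic remainder. *)
Lemma slope_le (f : R -> R) (g c K : R) :
  (forall e, 0 < e -> exists2 d : R, 0 < d & forall t, 0 < t < d -> `|f t + g * t| <= e * t) ->
  (exists2 d : R, 0 < d & forall t, 0 < t < d -> f t <= c * t + K * t ^+ 2) ->
  - g <= c.
Proof.
move=> hf [d d0 hd]; apply/ler_addgt0Pr => e e0.
have e2 : 0 < e / 2 by lra.
have [d' d'0 hd'] := hf _ e2.
have K0 : 0 < 2 * (`|K| + 1) by have := normr_ge0 K; lra.
have eK : 0 < e / (2 * (`|K| + 1)) by rewrite divr_gt0.
pose m := Num.min d (Num.min d' (e / (2 * (`|K| + 1)))).
have [m1 m2 m3] : [/\ m <= d, m <= d' & m <= e / (2 * (`|K| + 1))].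
  by rewrite /m !ge_min !lexx !orbT.
have m0 : 0 < m by rewrite !lt_min d0 d'0 eK.
pose t := m / 2.
have [t0 td td' te] : [/\ 0 < t, t < d, t < d' & t * (2 * (`|K| + 1)) < e].
  by rewrite -(ltr_pdivlMr _ _ K0) /t; split; lra.
have := hd t; rewrite t0 td => /(_ isT) h1.
have := hd' t; rewrite t0 td' => /(_ isT); rewrite ler_norml => /andP[h2 _].
have Kt : K * t <= e / 2.
  have : K * t <= `|K| * t by rewrite ler_pM2r // ler_norm.
  by lra.
rewrite -(ler_pM2r t0); have := ler_wpM2r (ltW t0) Kt; lra.
Qed.

Variables (a : R) (Om : set P) (u : P -> R) (psi : R -> R).
Hypothesis gs : graph_solution a Om u psi.

(** If [psi y0 > 5], the barrier of radius [psi y0 / 2] gives [- g1 <= 4 / psi y0 < 4/5], and the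
    cone with [s * psi y0 = a / 4] gives [a * |g2| <= 16], so [|g2| <= 1/2]. Then [g1^2 + g2^2] is
    below [16/25 + 1/4 < 1]. *)
Lemma psi_le5 y0 : 32 <= a -> `|y0| <= a / 2 -> psi y0 <= 5.
Proof.
move=> a32 y0a; rewrite leNgt; apply/negP => p5.
have ya0 : - a < y0 < a by move: y0a; rewrite ler_norml; lra.
have rp : 0 < psi y0 / 2 < psi y0 by lra.
have [m [k [k2 k0 bar]]] := barrier gs ya0 rp.
have [g1 [g2 [g12 hA hB]]] := boundary_gradient gs ya0.
set r := psi y0 / 2 in rp bar.
have r0 : 0 < r by lra.
have k1 : 1 <= k.
  by rewrite -(@ler_pXn2r _ 2) ?nnegrE ?ler01 ?(ltW k0) // expr1n k2 lerDl sqr_ge0.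
have g1r : - g1 <= 2 / r.
  apply: (slope_le (K := 1 / r ^+ 2) hA); exists r => // t /andP[t0 tr].
  have Ot : Om (psi y0 - t, y0) by apply/(Om_graph gs); lra.
  apply: le_trans (bar _ Ot _) _.
    by rewrite /sqdist /= subrr; nra.
  rewrite /= subrr (_ : psi y0 - t - psi y0 = - t); last by ring.
  have -> : ((0 + m * - t) / k) ^+ 2 - ((m * 0 - - t) / k) ^+ 2
      = ((m ^+ 2 - 1) / k ^+ 2) * t ^+ 2.
    by field; rewrite gt_eqF.
  have -> : (m * 0 - - t) / k = t / k by field; rewrite gt_eqF.
  have h1 : (m ^+ 2 - 1) / k ^+ 2 <= 1 by rewrite ler_pdivrMr ?exprn_gt0 // k2; lra.
  have h2 : t / k <= t by rewrite ler_pdivrMr // ler_peMr // ltW.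
  have t2 : 0 < t ^+ 2 by rewrite exprn_gt0.
  have r2 : 0 < (r ^+ 2)^-1 by rewrite invr_gt0 exprn_gt0.
  have ri : 0 < r^-1 by rewrite invr_gt0.
  rewrite addrC; apply: lerD.
    rewrite [2 / r * t]mulrAC; apply: ler_wpM2r; first exact: ltW.
    by rewrite ler_pM2l.
  have := ler_wpM2r (ltW r2) (ler_wpM2r (ltW t2) h1).
  by rewrite /= !mul1r [_^-1 * _]mulrC.
have s0 : 0 <= a / (4 * psi y0) by apply: divr_ge0; lra.
have p0 : 0 < psi y0 by lra.
have := hB _ s0.
have -> : a / (4 * psi y0) * psi y0 = a / 4 by field; rewrite gt_eqF.
have -> : a / 4 < a - `|y0| by lra.
move=> /(_ isT) g2b.
have rE : 2 / r = 4 / psi y0 by rewrite /r; field; rewrite gt_eqF.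
rewrite rE in g1r.
have : 4 / psi y0 < 4 / 5 by rewrite ltr_pdivrMr //; lra.
have : a * `|g2| <= 16.
  have : a / (4 * psi y0) * `|g2| <= 4 / psi y0 by exact: le_trans g1r.
  rewrite -(ler_pM2r (_ : 0 < 4 * psi y0)); last lra.
  have -> : a / (4 * psi y0) * `|g2| * (4 * psi y0) = a * `|g2| by field; rewrite gt_eqF.
  by have -> : 4 / psi y0 * (4 * psi y0) = 16 by field; rewrite gt_eqF.
have n2 := normr_ge0 g2.
have : g2 ^+ 2 = `|g2| ^+ 2 by rewrite real_normK ?num_real.
move=> g2E a16 h4.
have : 0 <= - g1 by apply: le_trans g2b; rewrite mulr_ge0.
have : `|g2| <= 1 / 2 by nra.
by rewrite g2E in g12; nra.
Qed.

(** The cone at [z] has slope at most [5 / (a / 2)]. *)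
Lemma psi_lipschitz y z : 32 <= a -> `|y| <= a / 2 -> `|z| <= a / 2 ->
  psi z - psi y <= 10 / a * `|z - y|.
Proof.
move=> a32 ya za.
have za' : - a < z < a by move: za; rewrite ler_norml; lra.
have ya' : - a <= y <= a by move: ya; rewrite ler_norml; lra.
have za'' : - a <= z <= a by lra.
have := psi_cone gs za' ya'; have pz5 := psi_le5 a32 za.
have pz0 := psi_gt0 gs za''.
rewrite distrC mulrBr mulr1.
have n0 := normr_ge0 (z - y).
have h1 : `|z - y| / (a - `|z|) <= `|z - y| / (a / 2).
  by rewrite ler_wpM2l // lef_pV2 ?posrE; lra.
have h2 : 0 <= `|z - y| / (a / 2) by apply: divr_ge0 => //; lra.
have -> : 10 / a * `|z - y| = 5 * (`|z - y| / (a / 2)) by field; rewrite gt_eqF //; lra.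
by nra.
Qed.

Lemma psi_continuous c d : 32 <= a -> - (a / 2) <= c -> d <= a / 2 ->
  {within `[c, d], continuous psi}.
Proof.
move=> a32 ca da; apply/subspace_continuousP => x.
rewrite /= in_itv /= => /andP[x1 x2].
apply/cvgrPdist_le => e e0; rewrite /prop_near1 /within /=.
have a0 : 0 < a by lra.
apply/nbhs_ballP; exists (e * a / 10) => /=; first by rewrite !mulr_gt0.
move=> y; rewrite /ball /= => xy; rewrite in_itv /= => /andP[y1 y2].
have xa : `|x| <= a / 2 by rewrite ler_norml; lra.
have ya : `|y| <= a / 2 by rewrite ler_norml; lra.
have := psi_lipschitz a32 xa ya; have := psi_lipschitz a32 ya xa.
rewrite [`|y - x|]distrC => h1 h2.
have : 10 / a * `|x - y| <= e.
  have -> : 10 / a * `|x - y| = `|x - y| / (a / 10) by field; rewrite gt_eqF.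
  by rewrite ler_pdivrMr ?divr_gt0 // mulrA ltW.
move=> he; suff : `|psi x - psi y| <= e by [].
by rewrite ler_norml; lra.
Qed.

End Slope.

(** * Comparison with the strip *)

Section Strip.
Variable R : realType.
Notation P := (R * R)%type.
Implicit Types (p q : P).
Variables (a : R) (Om : set P) (u : P -> R) (psi : R -> R).
Hypothesis gs : graph_solution a Om u psi.
Hypothesis a32 : 32 <= a.
Variable y0 : R.
Hypothesis y0a : `|y0| <= a / 4.

Let a0 : 0 < a. Proof. by move: a32; lra. Qed.
Let window y : `|y - y0| <= a / 4 -> `|y| <= a / 2.
Proof.
move: y0a; rewrite !ler_norml => /andP[? ?] /andP[? ?]; lra.
Qed.
Let in_a y : `|y| <= a / 2 -> - a <= y <= a.
Proof. by move: a0; rewrite ler_norml; lra. Qed.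
Let y0w : `|y0 - y0| <= a / 4. Proof. by move: a0; rewrite subrr normr0; lra. Qed.
Let psi_pos y : `|y - y0| <= a / 4 -> 0 < psi y.
Proof. by move=> /window /in_a /(psi_gt0 gs). Qed.

Let psi_double y : `|y - y0| <= a / 4 -> psi y <= 2 * psi y0.
Proof.
move=> yw; have ya := window yw; have py := psi_pos yw; have a1 := a0.
have ya' : - a < y < a by move: ya; rewrite ler_norml; lra.
have := psi_cone gs ya' (in_a (window y0w)).
have A0 : 0 < a - `|y| by lra.
have : `|y0 - y| / (a - `|y|) <= 1 / 2 by rewrite distrC ler_pdivrMr //; lra.
nra.
Qed.

Let d := 64 / a ^+ 2.
Let dE : d * a ^+ 2 = 64.
Proof. by rewrite divfK // gt_eqF // exprn_gt0. Qed.
Let d0 : 0 < d. Proof. by rewrite divr_gt0 // exprn_gt0. Qed.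
Let d1 : d <= 1 / 16.
Proof. by rewrite ler_pdivrMr ?exprn_gt0 //; have := a32; nra. Qed.

Let sq_window y : `|y - y0| <= a / 4 -> (y - y0) ^+ 2 <= (a / 4) ^+ 2.
Proof.
by move=> h; rewrite -real_normK ?num_real // lerXn2r ?nnegrE //; move: a0; lra.
Qed.
Let window_sq y : (y - y0) ^+ 2 <= (a / 4) ^+ 2 -> `|y - y0| <= a / 4.
Proof.
by move=> h; rewrite -(@ler_pXn2r _ 2) ?nnegrE // ?real_normK ?num_real //; move: a0; lra.
Qed.
Let window_eq y : (y - y0) ^+ 2 = (a / 4) ^+ 2 -> d * (y - y0) ^+ 2 = 4.
Proof. by move=> ->; rewrite expr_div_n mulrA dE; lra. Qed.

(** This is the value of [k] for which the polynomial [quad k s] below vanishes at the graph point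
    of ordinate [y]: [quad k s (psi y, y) = (F s y - k) * psi y]. The extremal [k] is thus an
    extremum of [F s]; the sign [s] distinguishes the upper barrier ([1]) from the lower one
    ([-1]). *)
Let F (s y : R) := (1 + s * d * (y - y0) ^+ 2) * (psi y)^-1 - s * d * psi y.

Let cF s : {within `[y0 - a / 4, y0 + a / 4], continuous (F s)}.
Proof.
have a1 := a0; have hw y : y0 - a / 4 <= y <= y0 + a / 4 -> `|y - y0| <= a / 4.
  by rewrite ler_distl.
have /subspace_continuousP cp : {within `[y0 - a / 4, y0 + a / 4], continuous psi}.
  by apply: (psi_continuous gs a32); move: y0a; rewrite ler_norml; lra.
apply/subspace_continuousP => x xI; have cx := cp x xI.
have px : psi x != 0.
  by rewrite gt_eqF // psi_pos // hw //; move: xI; rewrite /= in_itv.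
have cid : (fun y : R => y) @ within `[y0 - a / 4, y0 + a / 4] (nbhs x) --> x.
  by apply: cvg_within_filter; exact: cvg_id.
apply: cvgB; last by apply: cvgM => //; exact: cvg_cst.
apply: cvgM; last exact: cvgV.
apply: cvgD; first exact: cvg_cst.
apply: cvgM; first exact: cvg_cst.
have cs : (fun y : R => y - y0) @ within `[y0 - a / 4, y0 + a / 4] (nbhs x) --> x - y0.
  by apply: cvgB => //; exact: cvg_cst.
exact: (cvgM cs cs).
Qed.

Let F_psi s y : `|y - y0| <= a / 4 ->
  F s y * psi y = 1 + s * d * ((y - y0) ^+ 2 - psi y ^+ 2).
Proof. by move=> /psi_pos p; rewrite /F; field; rewrite gt_eqF. Qed.

Let quad (k s : R) (p : P) := 1 - k * p.1 + s * d * ((p.2 - y0) ^+ 2 - p.1 ^+ 2).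

Let harmonic_quad D k s : harmonic_on D (quad k s).
Proof.
apply: harmonic_ext (@harmonic_quadratic_at R D 1 (- k) 0 (- (s * d)) 0 0 y0) => p.
by rewrite /quad; ring.
Qed.

Let V (p : P) := (a / 4) ^+ 2 - (p.2 - y0) ^+ 2.

Let cV : continuous V.
Proof.
move=> p.
have cs : {for p, continuous (fun p : P => p.2 - y0)}.
  by apply: continuousB; [exact: cvg_snd|exact: cvg_cst].
have cc : {for p, continuous (fun=> (a / 4) ^+ 2 : R)} by exact: cvg_cst.
exact: (continuousB cc (continuousM cs cs)).
Qed.

Let bounded_V p : Om p -> 0 < V p -> `|p.1| <= a /\ `|p.2| <= a.
Proof.
case: p => x y Op; have a1 := a32; rewrite /V /= subr_gt0 => /ltW /window_sq /window ya.
have /andP[x0 xp] := (Om_graph gs x (in_a ya)).1 Op.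
have := psi_le5 gs a32 ya; rewrite gtr0_norm //; split; last lra.
by lra.
Qed.

Let bdry_V q : bdry Om q -> 0 <= V q ->
  (q.1 = 0 /\ u @ within Om (nbhs q) --> (1 : R)) \/
  (q.1 = psi q.2 /\ u @ within Om (nbhs q) --> (0 : R)).
Proof.
have a1 := a0; move=> bq; rewrite /V subr_ge0 => /window_sq /window qa.
have q0 : 0 <= q.1.
  rewrite leNgt; apply/negP => q10; case: bq => /closure_boxP clq _.
  have [|p Op [p1 _]] := clq (- q.1); first lra.
  by have := Om_gt0 gs Op; move: p1; rewrite ltr_distl; lra.
move: q0; rewrite le_eqVlt => /orP[/eqP q10|q10].
  left; split => //; case: (gs) => _ [_ _ _ [uK _] _] _; apply: uK.
    by split => //; exact: in_a.
  by move: qa; rewrite ler_norml; lra.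
right; split; last by have := u_bdry gs bq q10.
exact: (bdry_graph gs bq (in_a qa) q10).
Qed.

(** The cone of opening [a / 16] is admissible because [psi y1 <= 5], and it yields
    [|g2| <= 16 / a]. As [- g1] lies in [[0, 1]], it is at least [g1^2 >= 1 - 256 / a^2]. *)
Let grad_at y1 : `|y1 - y0| <= a / 4 -> exists g1 g2 : R,
  [/\ g1 ^+ 2 + g2 ^+ 2 = 1, forall e, 0 < e -> exists2 d : R, 0 < d &
        forall t, 0 < t < d -> `|u (psi y1 - t, y1) + g1 * t| <= e * t &
      1 - 256 / a ^+ 2 <= - g1 <= 1].
Proof.
move=> y1w; have ya := window y1w; have a1 := a32.
have ya' : - a < y1 < a by move: ya; rewrite ler_norml; lra.
have [g1 [g2 [g12 hA hB]]] := boundary_gradient gs ya'.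
exists g1, g2; split => //.
have := psi_le5 gs a32 ya; have := psi_pos y1w => p0 p5.
have s0 : 0 <= a / 16 by lra.
have /(hB _ s0) hg : a / 16 * psi y1 < a - `|y1| by nra.
have n2 := normr_ge0 g2.
have g10 : 0 <= - g1 by apply: le_trans hg; rewrite mulr_ge0.
have g2E : g2 ^+ 2 = `|g2| ^+ 2 by rewrite real_normK ?num_real.
have g11 : - g1 <= 1 by nra.
rewrite g11 andbT.
have g2a : `|g2| <= 16 / a by rewrite ler_pdivlMr //; lra.
have : g2 ^+ 2 <= 256 / a ^+ 2.
  have -> : 256 / a ^+ 2 = (16 / a) ^+ 2 by field; rewrite gt_eqF.
  by rewrite g2E lerXn2r ?nnegrE //; apply: divr_ge0; lra.
by nra.
Qed.

(** The minimum of [F 1] is the largest [k] keeping the polynomial nonnegative on the graph. At the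
    contact point the slopes compare as [1 - 256/a^2 <= - g1 <= k + 10 d], and [256 + 640 = 896] is
    rounded up to 900. *)
Lemma strip_upper : exists k : R, [/\ 1 - 900 / a ^+ 2 <= k, k * psi y0 <= 1 &
  forall x, 0 < x < psi y0 -> u (x, y0) <= 1 - k * x].
Proof.
have a1 := a32; have d0' := d0; have d1' := d1.
have [||y1] := @EVT_min R (F 1) (y0 - a / 4) (y0 + a / 4); first lra.
  exact: cF.
rewrite in_itv /= -ler_distl => y1w Fmin.
have {}Fmin y : `|y - y0| <= a / 4 -> F 1 y1 <= F 1 y.
  by rewrite ler_distl => yw; apply: Fmin; rewrite in_itv.
pose k := F 1 y1.
have quad_graph y : `|y - y0| <= a / 4 -> 0 <= quad k 1 (psi y, y).
  move=> yw; have := F_psi 1 yw; have := psi_pos yw; have := Fmin y yw.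
  by rewrite /quad /= -/k; nra.
have quad_y1 : quad k 1 (psi y1, y1) = 0.
  by have := F_psi 1 y1w; rewrite /quad /= -/k; lra.
have ky0 : k * psi y0 <= 1.
  have := F_psi 1 y0w; have := psi_pos y0w; have := Fmin y0 y0w.
  by rewrite -/k subrr; have := mulr_ge0 (ltW d0) (sqr_ge0 (psi y0)); nra.
(* The quadratic term contributes [4 - d * x^2], where [d * x^2 <= 2] because [x <= 5]; and
   [k * x <= 2] because [psi y <= 2 * psi y0] and [k * psi y0 <= 1]. *)
have quad_side x y : (y - y0) ^+ 2 = (a / 4) ^+ 2 -> 0 <= x <= psi y -> 1 <= quad k 1 (x, y).
  move=> yL /andP[x0 xp]; have yw : `|y - y0| <= a / 4 by apply: window_sq; rewrite yL.
  have := window_eq yL; have := psi_double yw; have := psi_le5 gs a32 (window yw).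
  move=> p5 p2 dy; rewrite /quad /= mul1r mulrBr dy.
  have dx : d * x ^+ 2 <= 2.
    have : x ^+ 2 <= 25 by nra.
    by have := sqr_ge0 x; nra.
  have kx : k * x <= 2.
    have [k0|k0] := leP 0 k; last by nra.
    apply: le_trans (_ : k * (2 * psi y0) <= _); last by lra.
    by rewrite ler_wpM2l // (le_trans xp).
  by lra.
(* The contact point is not on the sides of the window, where the polynomial is at least 1; the
   points to its left are therefore inside the comparison region. *)
have y1V : 0 < V (psi y1, y1).
  rewrite /V /= lt_neqAle subr_ge0 sq_window // andbT eq_sym subr_eq0.
  apply/eqP => yL; have := quad_side (psi y1) y1 (esym yL).
  by rewrite quad_y1 lexx (ltW (psi_pos y1w)) => /(_ isT); rewrite ler10.
have cmp p : Om p -> 0 < V p -> u p <= quad k 1 p.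
  apply: (comparison (open_Om gs) (harmonic_u gs) (harmonic_quad Om k 1) cV bounded_V).
    case=> x y Oq /eqP; rewrite /V subr_eq0 eq_sym => /eqP /= yL.
    have yw : `|y - y0| <= a / 4 by apply: window_sq; rewrite yL.
    have /andP[x0 xp] := (Om_graph gs x (in_a (window yw))).1 Oq.
    have /andP[_ /le_trans] := u_bounds gs Oq; apply.
    by apply: quad_side; rewrite ?(ltW x0) ?(ltW xp).
  move=> q bq Vq.
  have cq : {for q, continuous (quad k 1)}
    by exact: harmonic_continuous (harmonic_quad setT k 1) I.
  have [[q1 uq]|[q1 uq]] := bdry_V bq Vq; apply: within_cvg_le uq cq _.
    rewrite /quad q1 mulr0 subr0 expr0n subr0 lerDl mul1r mulr_ge0 ?sqr_ge0 //; exact: ltW.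
  rewrite [q]surjective_pairing q1; apply: quad_graph; apply: window_sq.
  by rewrite /V subr_ge0 in Vq.
exists k; split => //.
  have [g1 [g2 [g12 hA /andP[g1l g1u]]]] := grad_at y1w.
  have p5 := psi_le5 gs a32 (window y1w); have p0 := psi_pos y1w.
  have : - g1 <= k + 10 * d.
    apply: (slope_le (K := 0) hA); exists (psi y1) => // t /andP[t0 tp].
    have Ot : Om (psi y1 - t, y1) by apply/(Om_graph gs); [exact/in_a/window|lra].
    apply: le_trans (cmp _ Ot y1V) _.
    have -> : quad k 1 (psi y1 - t, y1)
        = quad k 1 (psi y1, y1) + k * t + d * (2 * psi y1 * t - t ^+ 2).
      by rewrite /quad /=; ring.
    have : d * (2 * psi y1 * t - t ^+ 2) <= d * (10 * t).
      by rewrite ler_pM2l //; have := sqr_ge0 t; nra.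
    by rewrite quad_y1; lra.
  have -> : 900 / a ^+ 2 = 256 / a ^+ 2 + 10 * d + 4 / a ^+ 2
    by rewrite /d; field; rewrite gt_eqF.
  have : 0 < 4 / a ^+ 2 by rewrite divr_gt0 // exprn_gt0.
  lra.
move=> x xp; have Ox : Om (x, y0) by apply/(Om_graph gs) => //; exact/in_a/window.
have Vx : 0 < V (x, y0) by rewrite /V /= subrr expr0n subr0 exprn_gt0 // divr_gt0.
apply: le_trans (cmp _ Ox Vx) _.
by rewrite /quad /= subrr; have := mulr_ge0 (ltW d0) (sqr_ge0 x); lra.
Qed.

(** The mirror argument with the maximum of [F (-1)]: the polynomial is negative on the sides, and
    the contact point gives [k - 10 d <= - g1 <= 1], that is [k <= 1 + 640/a^2], weakened to match
    the upper estimate. *)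
Lemma strip_lower : exists k : R, [/\ k <= 1 + 900 / a ^+ 2, 1 <= k * psi y0 &
  forall x, 0 < x < psi y0 -> 1 - k * x <= u (x, y0)].
Proof.
have a1 := a32; have d0' := d0; have d1' := d1.
have [||y1] := @EVT_max R (F (-1)) (y0 - a / 4) (y0 + a / 4); first lra.
  exact: cF.
rewrite in_itv /= -ler_distl => y1w Fmax.
have {}Fmax y : `|y - y0| <= a / 4 -> F (-1) y <= F (-1) y1.
  by rewrite ler_distl => yw; apply: Fmax; rewrite in_itv.
pose k := F (-1) y1.
have quad_graph y : `|y - y0| <= a / 4 -> quad k (-1) (psi y, y) <= 0.
  move=> yw; have := F_psi (-1) yw; have := psi_pos yw; have := Fmax y yw.
  by rewrite /quad /= -/k; nra.
have quad_y1 : quad k (-1) (psi y1, y1) = 0.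
  by have := F_psi (-1) y1w; rewrite /quad /= -/k; lra.
have ky0 : 1 <= k * psi y0.
  have := F_psi (-1) y0w; have := psi_pos y0w; have := Fmax y0 y0w.
  by rewrite -/k subrr; have := mulr_ge0 (ltW d0) (sqr_ge0 (psi y0)); nra.
have k0 : 0 <= k by have := psi_pos y0w; nra.
have quad_side x y : (y - y0) ^+ 2 = (a / 4) ^+ 2 -> 0 <= x <= psi y -> quad k (-1) (x, y) < 0.
  move=> yL /andP[x0 xp]; have yw : `|y - y0| <= a / 4 by apply: window_sq; rewrite yL.
  have := window_eq yL; have := psi_le5 gs a32 (window yw).
  move=> p5 dy; rewrite /quad /= mulN1r mulNr mulrBr dy.
  have dx : d * x ^+ 2 <= 2.
    have : x ^+ 2 <= 25 by nra.
    by have := sqr_ge0 x; nra.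
  by have := mulr_ge0 k0 x0; lra.
have y1V : 0 < V (psi y1, y1).
  rewrite /V /= lt_neqAle subr_ge0 sq_window // andbT eq_sym subr_eq0.
  apply/eqP => yL; have := quad_side (psi y1) y1 (esym yL).
  by rewrite quad_y1 lexx (ltW (psi_pos y1w)) => /(_ isT); rewrite ltxx.
have cmp p : Om p -> 0 < V p -> quad k (-1) p <= u p.
  apply: (comparison (open_Om gs) (harmonic_quad Om k (-1)) (harmonic_u gs) cV bounded_V).
    case=> x y Oq /eqP; rewrite /V subr_eq0 eq_sym => /eqP /= yL.
    have yw : `|y - y0| <= a / 4 by apply: window_sq; rewrite yL.
    have /andP[x0 xp] := (Om_graph gs x (in_a (window yw))).1 Oq.
    have /andP[u0 _] := u_bounds gs Oq; apply: le_trans u0.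
    by apply/ltW/quad_side; rewrite ?(ltW x0) ?(ltW xp).
  move=> q bq Vq.
  have cq : {for q, continuous (quad k (-1))}
    by exact: harmonic_continuous (harmonic_quad setT k (-1)) I.
  have [[q1 uq]|[q1 uq]] := bdry_V bq Vq; apply: within_cvg_ge uq cq _.
    rewrite /quad q1 mulr0 subr0 expr0n subr0 gerDl mulN1r mulNr oppr_le0.
    by rewrite mulr_ge0 ?sqr_ge0 //; exact: ltW.
  rewrite [q]surjective_pairing q1; apply: quad_graph; apply: window_sq.
  by rewrite /V subr_ge0 in Vq.
exists k; split => //.
  have [g1 [g2 [g12 hA /andP[g1l g1u]]]] := grad_at y1w.
  have p5 := psi_le5 gs a32 (window y1w); have p0 := psi_pos y1w.
  have : - - g1 <= - (k - 10 * d).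
    apply: (slope_le (f := fun t => - u (psi y1 - t, y1)) (K := 0)).
      move=> e /hA[c c0 hc]; exists c => // t /hc.
      by rewrite -normrN opprD mulNr.
    exists (psi y1) => // t /andP[t0 tp].
    have Ot : Om (psi y1 - t, y1) by apply/(Om_graph gs); [exact/in_a/window|lra].
    have := cmp _ Ot y1V.
    have -> : quad k (-1) (psi y1 - t, y1)
        = quad k (-1) (psi y1, y1) + k * t - d * (2 * psi y1 * t - t ^+ 2).
      by rewrite /quad /=; ring.
    have : d * (2 * psi y1 * t - t ^+ 2) <= d * (10 * t).
      by rewrite ler_pM2l //; have := sqr_ge0 t; nra.
    by rewrite quad_y1; lra.
  have -> : 900 / a ^+ 2 = 10 * d + 260 / a ^+ 2 by rewrite /d; field; rewrite gt_eqF.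
  have : 0 < 260 / a ^+ 2 by apply: divr_gt0; [rewrite ltr0n|exact: exprn_gt0].
  lra.
move=> x xp; have Ox : Om (x, y0) by apply/(Om_graph gs) => //; exact/in_a/window.
have Vx : 0 < V (x, y0) by rewrite /V /= subrr expr0n subr0 exprn_gt0 // divr_gt0.
apply: le_trans (cmp _ Ox Vx).
by rewrite /quad /= subrr; have := mulr_ge0 (ltW d0) (sqr_ge0 x); lra.
Qed.

End Strip.

(** * Gradient estimates *)

Section GradientEstimate.
Variable R : realType.
Notation P := (R * R)%type.
Implicit Types (p q : P) (D : set P).

Lemma continuous_pair (f g : P -> R) p : {for p, continuous f} ->
  {for p, continuous g} -> {for p, continuous (fun q => (f q, g q))}.
Proof.
move=> /cvg_boxP cf /cvg_boxP cg A /nbhs_boxP[e e0 hA].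
have [d d0 hd] := cf e e0; have [d' d'0 hd'] := cg e e0.
apply/nbhs_boxP; exists (Num.min d d') => [|q]; first by rewrite lt_min d0.
by rewrite !lt_min => /andP[? ?] /andP[? ?]; apply: hA; [exact: hd|exact: hd'].
Qed.

Lemma harmonic_swap D (w : P -> R) : harmonic_on D w ->
  harmonic_on [set p | D (p.2, p.1)] (fun p => w (p.2, p.1)).
Proof.
move=> [w1 [w2 hw]]; exists (fun p => w2 (p.2, p.1)), (fun p => w1 (p.2, p.1)).
move=> p /= /hw[cw [w11 [w22 [a1 a2 a3 a4 a5]]]]; split.
  have cs : {for p, continuous (fun p : P => (p.2, p.1))}.
    by apply: continuous_pair; [exact: cvg_snd|exact: cvg_fst].
  exact: (continuous_comp cs cw).
by exists w22, w11; split => //; rewrite addrC.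
Qed.

Lemma is_derive_reflect (f : R -> R) (c t l : R) : is_derive (c - t) 1 f l ->
  is_derive t 1 (fun s => f (c - s)) (- l).
Proof.
move=> /is_derive_epsP H; apply/is_derive_epsP => e /H[d d0 hd].
exists d => // h hd'; have := hd (- h); rewrite normrN => /(_ hd').
by rewrite opprD addrA mulNr mulrN.
Qed.

Lemma harmonic_reflect D (w : P -> R) (c : R) : harmonic_on D w ->
  harmonic_on [set p | D (c - p.1, p.2)] (fun p => w (c - p.1, p.2)).
Proof.
move=> [w1 [w2 hw]].
exists (fun p => - w1 (c - p.1, p.2)), (fun p => w2 (c - p.1, p.2)).
move=> [x y] /= /hw[cw [w11 [w22 [a1 a2 a3 a4 a5]]]]; split.
  have cs : {for (x, y), continuous (fun p : P => (c - p.1, p.2))}.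
    apply: continuous_pair; last exact: cvg_snd.
    by apply: continuousB; [exact: cvg_cst|exact: cvg_fst].
  exact: (continuous_comp cs cw).
exists w11, w22; split => //=.
- exact: (is_derive_reflect (f := fun t => w (t, y))).
- rewrite -[w11]opprK.
  exact: (is_deriveN (is_derive_reflect (f := fun t => w1 (t, y)) a3)).
Qed.

(* The odd part of [w] across the vertical line through [p] is compared on a
   half disk with the harmonic barrier [(Y^2 - X^2)/r^2 + 2X/r]. *)
Lemma harmonic_d1_le D (w : P -> R) p (l r S : R) : open D -> harmonic_on D w ->
  is_derive p.1 1 (fun t => w (t, p.2)) l -> 0 < r ->
  (forall q, sqdist p q <= r ^+ 2 -> D q /\ `|w q| <= S) -> l <= 2 * S / r.
Proof.
case: p => c y /= oD hw dw r0 disk.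
pose rho (q : P) : P := (2 * c - q.1, q.2).
have crho : continuous rho.
  move=> q; apply: continuous_pair; last exact: cvg_snd.
  by apply: continuousB; [exact: cvg_cst|exact: cvg_fst].
pose D' := D `&` [set q | D (rho q)].
have oD' : open D'.
  apply: openI => //; apply: (open_comp (f := rho) (D := D)) => //.
pose W q := w q - w (rho q).
have hW : harmonic_on D' W.
  apply: harmonicB; first by apply: harmonic_sub hw => q [].
  by apply: harmonic_sub (harmonic_reflect (2 * c) hw) => q [].
pose h (q : P) := 2 * S * (((q.2 - y) ^+ 2 - (q.1 - c) ^+ 2) / r ^+ 2 + 2 * (q.1 - c) / r).
have hh : harmonic_on D' h.
  apply: harmonic_ext (@harmonic_quadratic_at R D' 0 (4 * S / r) 0
    (- (2 * S / r ^+ 2)) 0 c y) => q.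
  by rewrite /h; field; rewrite gt_eqF.
pose V q := Num.min (q.1 - c) (r ^+ 2 - sqdist (c, y) q).
have cV : continuous V.
  move=> q.
  have c1 : {for q, continuous (fun q : P => q.1 - c)}.
    by apply: continuousB; [exact: cvg_fst|exact: cvg_cst].
  exact: (continuous_min c1 (@continuous_subr_sqdist R (r ^+ 2) (c, y) q)).
have sq_rho q : sqdist (c, y) (rho q) = sqdist (c, y) q by rewrite /sqdist /=; ring.
have inD q : sqdist (c, y) q <= r ^+ 2 -> D' q /\ W q <= 2 * S.
  move=> qr; have [Dq wq] := disk q qr; have [] := disk (rho q); first by rewrite sq_rho.
  move=> Drq wrq; split => //; rewrite /W.
  by move: wq wrq; rewrite !ler_norml => /andP[? ?] /andP[? ?]; lra.
have S0 : 0 <= S.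
  have [|_] := disk (c, y); last by apply: le_trans.
  by rewrite /sqdist !subrr expr0n addr0 exprn_ge0 // ltW.
have Vr q : 0 <= V q ->
    [/\ 0 <= q.1 - c, q.1 - c <= r, `|q.2 - y| <= r & sqdist (c, y) q <= r ^+ 2].
  rewrite /V le_min => /andP[x0]; rewrite subr_ge0 => qr; split => //.
    rewrite -(@ler_pXn2r _ 2) ?nnegrE ?(ltW r0) //; apply: le_trans qr.
    by rewrite /sqdist lerDl sqr_ge0.
  rewrite -(@ler_pXn2r _ 2) ?nnegrE ?(ltW r0) // real_normK ?num_real //.
  by apply: le_trans qr; rewrite /sqdist lerDr sqr_ge0.
have cmp q : D' q -> 0 < V q -> W q <= h q.
  apply: (@comparison R D' W h V (`|c| + `|y| + r)) => //.
  - move=> x _ /ltW /Vr[]; rewrite !ler_norml => x1 x2 /andP[? ?] _.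
    have := ler_norm c; have := ler_norm (- c); have := ler_norm y; have := ler_norm (- y).
    by rewrite !normrN => ? ? ? ?; split; lra.
  - move=> x D'x V0; have [x1 x2 x3 x4] : [/\ 0 <= x.1 - c, x.1 - c <= r,
      `|x.2 - y| <= r & sqdist (c, y) x <= r ^+ 2] by apply: Vr; rewrite V0.
    have X1 : (x.1 - c) / r <= 1 by rewrite ler_pdivrMr // mul1r.
    have X0 : 0 <= (x.1 - c) / r by rewrite divr_ge0 // ltW.
    (* On the axis the second term and [W] vanish, so [W <= h]; on the circle the first term is 1
       and the second is nonnegative, so [h >= 2 * S >= W]. *)
    have hE : h x = 2 * S * (sqdist (c, y) x / r ^+ 2
        + 2 * ((x.1 - c) / r) * (1 - (x.1 - c) / r)).
      by rewrite /h /sqdist /=; field; rewrite gt_eqF.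
    have [_ W2] := inD x x4.
    have : (x.1 - c == 0) || (r ^+ 2 - sqdist (c, y) x == 0).
      by move: V0; rewrite /V minEle; case: ifP => _ ->; rewrite eqxx ?orbT.
    rewrite !subr_eq0 => /orP[] /eqP xE.
      have rx : rho x = x.
        by rewrite [RHS]surjective_pairing; congr pair; rewrite xE; ring.
      rewrite /W rx subrr hE xE subrr mul0r mulr0 mul0r addr0.
      by rewrite !mulr_ge0 ?sqdist_ge0 // invr_ge0 exprn_ge0 // ltW.
    apply: le_trans W2 _; rewrite hE -xE divff ?gt_eqF ?exprn_gt0 //.
    rewrite -[leLHS]mulr1 ler_wpM2l ?mulr_ge0 // lerDl.
    by apply: mulr_ge0; [exact: mulr_ge0|rewrite subr_ge0].
  (* The closed disk lies in [D'], so it meets no boundary point of [D']. *)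
  - by move=> x [_ nx] /Vr[_ _ _ /inD[]].
have dW e : 0 < e -> exists2 d : R, 0 < d & forall t, 0 < t < d ->
    `|W (c + t, y) + - (2 * l) * t| <= e * t.
  move=> e0; have e20 : 0 < e / 2 by lra.
  have /is_derive_epsP/(_ _ e20)[d d0 hd] := dw.
  exists d => // t /andP[t0 td].
  have := hd t; have := hd (- t); rewrite normrN gtr0_norm // td => /(_ isT) h1 /(_ isT).
  rewrite /W /rho /= (_ : 2 * c - (c + t) = c - t); last by ring.
  move: h1; rewrite !ler_norml => /andP[? ?] /andP[? ?]; lra.
(* At the centre the difference [W] has slope [2 * l] and the barrier has slope [4 * S / r]. *)
have : - - (2 * l) <= 4 * S / r.
  apply: (slope_le (K := 0) dW); exists r => // t /andP[t0 tr].
  have tt : t ^+ 2 < r ^+ 2 by nra.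
  have ct : c + t - c = t by ring.
  have sE : sqdist (c, y) (c + t, y) = t ^+ 2 by rewrite /sqdist /= ct; ring.
  have [D't _] : D' (c + t, y) /\ W (c + t, y) <= 2 * S by apply: inD; rewrite sE ltW.
  have := cmp _ D't; rewrite /V lt_min sE /= ct t0 subr_gt0 tt => /(_ isT) /le_trans; apply.
  rewrite /h /= ct subrr mul0r addr0.
  have -> : 2 * S * ((0 ^+ 2 - t ^+ 2) / r ^+ 2 + 2 * t / r)
      = 4 * S / r * t - 2 * S * (t / r) ^+ 2.
    by field; rewrite gt_eqF.
  by rewrite gerBl mulr_ge0 ?sqr_ge0 // mulr_ge0.
by rewrite opprK; lra.
Qed.

Lemma harmonic_gradient_le D (w : P -> R) p (l1 l2 r S : R) : open D ->
  harmonic_on D w -> is_derive p.1 1 (fun t => w (t, p.2)) l1 ->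
  is_derive p.2 1 (fun t => w (p.1, t)) l2 -> 0 < r ->
  (forall q, sqdist p q <= r ^+ 2 -> D q /\ `|w q| <= S) ->
  `|l1| <= 2 * S / r /\ `|l2| <= 2 * S / r.
Proof.
have main D0 (w0 : P -> R) p0 (l : R) : open D0 -> harmonic_on D0 w0 ->
    is_derive p0.1 1 (fun t => w0 (t, p0.2)) l -> 0 < r ->
    (forall q, sqdist p0 q <= r ^+ 2 -> D0 q /\ `|w0 q| <= S) -> `|l| <= 2 * S / r.
  move=> oD hw dw r0 disk; rewrite ler_norml; apply/andP; split; last first.
    exact: harmonic_d1_le oD hw dw r0 disk.
  rewrite lerNl; apply: (@harmonic_d1_le D0 (fun q => - w0 q) p0) => //.
    by apply: harmonic_ext (harmonicZ (-1) hw) => q; rewrite mulN1r.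
  by move=> q /disk; rewrite normrN.
move=> oD hw dw1 dw2 r0 disk; split; first exact: (main D w p).
apply: (main _ (fun q => w (q.2, q.1)) (p.2, p.1) _ _ (harmonic_swap hw)) => //.
  apply: (open_comp (f := fun q : P => (q.2, q.1)) (D := D)) => // q _.
  by apply: continuous_pair; [exact: cvg_snd|exact: cvg_fst].
by move=> q; rewrite /sqdist /= addrC => /(disk (q.2, q.1)).
Qed.

End GradientEstimate.

(** * Gradient bounds for the solution, inside and near the graph *)

Section GradientBounds.
Variable R : realType.
Notation P := (R * R)%type.
Implicit Types (p q : P).
Variables (a : R) (Om : set P) (u : P -> R) (psi : R -> R).
Hypothesis gs : graph_solution a Om u psi.

Lemma psi_strip y : 32 <= a -> `|y| <= a / 4 ->
  (1 - 900 / a ^+ 2) * psi y <= 1 <= (1 + 900 / a ^+ 2) * psi y.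
Proof.
move=> a32 ya; have ya' : - a <= y <= a by move: ya; rewrite ler_norml; lra.
have p0 := psi_gt0 gs ya'.
have [k [k1 k2 _]] := strip_upper gs a32 ya; have [k' [k1' k2' _]] := strip_lower gs a32 ya.
apply/andP; split.
  by apply: le_trans k2; rewrite ler_pM2r.
by apply: le_trans k2' _; rewrite ler_pM2r.
Qed.

Lemma u_strip x y : 32 <= a -> `|y| <= a / 4 -> Om (x, y) ->
  `|u (x, y) - (1 - x)| <= 900 / a ^+ 2 * x.
Proof.
move=> a32 ya; have ya' : - a <= y <= a by move: ya; rewrite ler_norml; lra.
move=> /(Om_graph gs x ya') xp; have /andP[x0 _] := xp.
have [k [k1 _ /(_ x xp) k3]] := strip_upper gs a32 ya.
have [k' [k1' _ /(_ x xp) k3']] := strip_lower gs a32 ya.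
rewrite ler_norml; apply/andP; split.
  have : k' * x <= (1 + 900 / a ^+ 2) * x by rewrite ler_pM2r.
  by lra.
have : (1 - 900 / a ^+ 2) * x <= k * x by rewrite ler_pM2r.
by lra.
Qed.

Lemma sqdist_lt_coord p q r : 0 <= r -> sqdist p q <= r ^+ 2 ->
  `|q.1 - p.1| <= r /\ `|q.2 - p.2| <= r.
Proof.
rewrite /sqdist => r0 h.
have := sqr_ge0 (q.1 - p.1); have := sqr_ge0 (q.2 - p.2) => ? ?.
by split; rewrite -(@ler_pXn2r _ 2) ?nnegrE ?normr_ge0 // real_normK ?num_real //; lra.
Qed.

(** The estimate is applied to [u - (1 - x)], which is at most [2 k x] in size on the disk of radius
    [e x]: both scale with [x], so nothing is lost near [K_a]. The disk stays in [Om] because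
    [(1 + e) (1 - 2 e) < 1 - e <= psi]. *)
Lemma gradient_inside x y (e : R) : 32 <= a -> 0 < e <= 1 / 4 -> 900 / a ^+ 2 <= e ->
  `|y| <= a / 8 -> Om (x, y) -> x <= 1 - 2 * e ->
  `|d1 u (x, y) + 1| <= 4 * (900 / a ^+ 2) / e /\
  `|d2 u (x, y)| <= 4 * (900 / a ^+ 2) / e.
Proof.
move=> a32 /andP[e0 e1]; set k := 900 / a ^+ 2 => ke ya Oxy x1.
have a2 : 0 < a ^+ 2 by rewrite exprn_gt0 //; lra.
have k0 : 0 < k by apply: divr_gt0 a2; rewrite ltr0n.
have x0 := Om_gt0 gs Oxy; rewrite /= in x0.
have [du1 du2] := is_derive_u gs Oxy.
pose v (p : P) := u p + (p.1 - 1).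
have hv : harmonic_on Om v.
  apply: harmonicD (harmonic_u gs) _.
  by apply: harmonic_ext (@harmonic_quadratic R Om (-1) 1 0 0 0) => p; ring.
have dv1 : is_derive x 1 (fun t => v (t, y)) (d1 u (x, y) + 1).
  have := is_deriveD du1 (is_deriveB (is_derive_id x 1) (is_derive_cst (1 : R) x 1)).
  by rewrite subr0.
have dv2 : is_derive y 1 (fun t => v (x, t)) (d2 u (x, y)).
  have := is_deriveD du2 (is_derive_cst (x - 1) y 1).
  by rewrite addr0.
have r0 : 0 < e * x by rewrite mulr_gt0.
have := @harmonic_gradient_le R Om v (x, y) (d1 u (x, y) + 1) (d2 u (x, y)) (e * x)
  (2 * k * x) (open_Om gs) hv dv1 dv2 r0.
have -> : 2 * (2 * k * x) / (e * x) = 4 * k / e.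
  by move: (k) => k'; field; rewrite !gt_eqF.
apply.
move=> [q1 q2] /(sqdist_lt_coord (ltW r0)) [/=].
have ex : e * x <= 1 / 4 by nra.
move=> /[dup] h1; rewrite ler_distl => /andP[h1l h1r] h2.
have qa : `|q2| <= a / 4.
  have : `|q2| <= `|q2 - y| + `|y| by rewrite -{1}(subrK y q2) ler_normD.
  lra.
have q10 : 0 < q1 by nra.
have /andP[_ p1] := psi_strip a32 qa.
have qa' : - a <= q2 <= a by move: qa; rewrite ler_norml; lra.
have p0 := psi_gt0 gs qa'.
have Oq : Om (q1, q2).
  apply/(Om_graph gs) => //; rewrite q10 /=.
  have : q1 <= (1 + e) * (1 - 2 * e).
    by apply: le_trans h1r _; rewrite -[X in X + _]mul1r -mulrDl ler_pM2l //; lra.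
  have : 1 - e <= psi q2 by rewrite -/k in p1; nra.
  by nra.
split => //; have := u_strip a32 qa Oq.
rewrite -/k opprB /v /= => uq; apply: le_trans uq _.
have qx : q1 <= 2 * x by nra.
by have := ler_wpM2l (ltW k0) qx; lra.
Qed.

(** With [d = psi y - x], the disk of radius [d / 4] lies in [Om] by [psi_cone], and the barrier of
    radius [9/10] at [(psi y, y)] gives [u <= 5 d] on it. The quotient [2 * (5 d) / (d / 4) = 40] no
    longer depends on [d]. *)
Lemma gradient_near_graph x y : 300 <= a -> `|y| <= a / 8 -> Om (x, y) -> 1 / 2 <= x ->
  `|d1 u (x, y)| <= 40 /\ `|d2 u (x, y)| <= 40.
Proof.
move=> a300 ya Oxy x12.
have a32 : 32 <= a by lra.
have k1 : 900 / a ^+ 2 <= 1 / 100 by rewrite ler_pdivrMr ?exprn_gt0 //; nra.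
have ya4 : `|y| <= a / 4 by lra.
have ya' : - a < y < a by move: ya; rewrite ler_norml; lra.
have ya'' : - a <= y <= a by lra.
have p0 := psi_gt0 gs ya''.
have /andP[pu pl] := psi_strip a32 ya4.
have [pl' pu'] : 99 / 100 <= psi y /\ psi y <= 102 / 100 by split; nra.
clear a32 k1 ya4 pu pl.
have /andP[x0 xp] := (Om_graph gs x ya'').1 Oxy.
pose d := psi y - x; have d0 : 0 < d by rewrite /d; lra.
have dle : d <= 52 / 100 by rewrite /d; lra.
have rp : 0 < (9 / 10 : R) < psi y by lra.
have [m [k [k2 k0 bar]]] := barrier gs ya' rp.
have [du1 du2] := is_derive_u gs Oxy.
have r0 : 0 < d / 4 by lra.
have := @harmonic_gradient_le R Om u (x, y) _ _ (d / 4) (5 * d) (open_Om gs)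
  (harmonic_u gs) du1 du2 r0.
have -> : 2 * (5 * d) / (d / 4) = 40 by field; rewrite gt_eqF.
apply => -[q1 q2] /(sqdist_lt_coord (ltW r0)) [/= h1 h2].
have n2 := normr_ge0 (q2 - y).
have qa : - a <= q2 <= a.
  by move: ya h2; rewrite ler_norml ler_distl => /andP[? ?] /andP[? ?]; apply/andP; lra.
have Oq : Om (q1, q2).
  apply/(Om_graph gs) => //; move: h1; rewrite ler_distl => /andP[h1 h1'].
  rewrite /d in h1 h1' *; apply/andP; split; first lra.
  have := psi_cone gs ya' qa; rewrite mulrBr mulr1.
  have : psi y * (`|q2 - y| / (a - `|y|)) <= d / 4.
    apply: le_trans h2; rewrite mulrA ler_pdivrMr; last lra.
    by rewrite mulrC; apply: ler_wpM2l => //; lra.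
  rewrite /d; lra.
split => //; have /andP[u0 _] := u_bounds gs Oq; rewrite ger0_norm //.
clear n2 qa u0; have X : `|q1 - psi y| <= 5 / 4 * d.
  by move: h1; rewrite !ler_distl /d => /andP[? ?]; apply/andP; split; lra.
have sX : (q1 - psi y) ^+ 2 <= (5 / 4 * d) ^+ 2.
  by rewrite -real_normK ?num_real // lerXn2r ?nnegrE //; lra.
have sY : (q2 - y) ^+ 2 <= (d / 4) ^+ 2.
  by rewrite -real_normK ?num_real // lerXn2r ?nnegrE //; lra.
clear a300 ya ya' ya'' h1 h2 X x0 xp pl' pu' r0 x12 du1 du2 Oxy rp; clearbody d.
have dd : d ^+ 2 <= 52 / 100 * d by rewrite expr2 ler_pM2r.
(* Here [(5/4)^2 + (1/4)^2 = 26/16 <= (13/10)^2]; since [d <= 52/100], the point is within the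
   barrier's radius [9/10]. *)
have sq : sqdist (psi y, y) (q1, q2) <= (13 / 10 * d) ^+ 2.
  by have := sqr_ge0 d; rewrite /sqdist /=; lra.
apply: le_trans (bar _ Oq _) _; first by nra.
set T := (_ / k); set S := (_ / k).
have ST : S ^+ 2 + T ^+ 2 = sqdist (psi y, y) (q1, q2).
  have -> : S ^+ 2 + T ^+ 2 = sqdist (psi y, y) (q1, q2) * (1 + m ^+ 2) / k ^+ 2.
    by rewrite /S /T /sqdist /=; field; rewrite gt_eqF.
  by rewrite -k2 mulfK // gt_eqF // exprn_gt0.
have S1 : S <= 13 / 10 * d.
  apply: le_trans (ler_norm _) _.
  rewrite -(@ler_pXn2r _ 2) ?nnegrE // ?real_normK ?num_real //; last lra.
  by have := sqr_ge0 T; lra.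
have h : (T ^+ 2 - S ^+ 2) / (9 / 10) ^+ 2 <= 100 / 81 * (169 / 100) * (52 / 100 * d).
  have -> : (T ^+ 2 - S ^+ 2) / (9 / 10) ^+ 2 = 100 / 81 * (T ^+ 2 - S ^+ 2) by field.
  by have := sqr_ge0 S; lra.
have -> : 2 * S / (9 / 10) = 20 / 9 * S by field.
lra.
Qed.

End GradientBounds.

(** * Weak gradient of the extension by zero *)

Section PlaneIntegral.
Variable R : realType.
Notation P := (R * R)%type.
Notation mu := (@lebesgue_measure R).
Local Notation M2 := (measurableTypeR R * measurableTypeR R)%type.
Implicit Types p : P.

(** An open set is the union of the rational boxes that it contains; the other boxes are replaced by
    [set0], so that the union runs over all rational triples. *)
Lemma open_measurable_plane (A : set P) : open A -> measurable (A : set M2).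
Proof.
move=> oA.
pose box (q : rat * rat * rat) : set M2 :=
  `]ratr q.1.1 - ratr q.2, ratr q.1.1 + ratr q.2[ `*`
  `]ratr q.1.2 - ratr q.2, ratr q.1.2 + ratr q.2[.
pose F q := if `[< box q `<=` A >] then box q else set0.
have -> : (A : set M2) = \bigcup_q F q.
  apply/seteqP; split => [[x y] Axy|p [q _]]; last first.
    by rewrite /F; case: asboolP => [h /h|_ []].
  have [e e0 he] := open_boxP oA Axy.
  have e40 : 0 < e / 4 by lra.
  have [r /andP[r1 r2]] : exists r : rat, e / 4 < ratr r < e / 2.
    by have [|r] := @rat_in_itvoo R (e / 4) (e / 2); [lra|rewrite in_itv /= => h; exists r].
  have [s /andP[s1 s2]] : exists s : rat, x - e / 4 < ratr s < x + e / 4.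
    by have [|s] := @rat_in_itvoo R (x - e / 4) (x + e / 4);
      [lra|rewrite in_itv /= => h; exists s].
  have [t /andP[t1 t2]] : exists t : rat, y - e / 4 < ratr t < y + e / 4.
    by have [|t] := @rat_in_itvoo R (y - e / 4) (y + e / 4);
      [lra|rewrite in_itv /= => h; exists t].
  exists (s, t, r) => //; rewrite /F asboolT.
    by rewrite /box /= !in_itv /=; split; lra.
  move=> [x' y'] /=; rewrite /box /= !in_itv /= => -[/andP[? ?] /andP[? ?]].
  by apply: he => /=; rewrite ltr_distl; lra.
apply: countable_bigcupT_measurable => [|q]; first exact: countableP.
rewrite /F; case: asboolP => // _.
by apply: measurableX; exact: measurable_itv.
Qed.

Lemma continuous_on_open_measurable (D : set P) (f : P -> R) : open D ->
  (forall p, D p -> {for p, continuous f}) -> measurable_fun (D : set M2) f.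
Proof.
move=> oD cf; apply: (measurability _ (RGenOInfty.measurableE R)).
move=> _ [_ [a ->] <-]; apply: open_measurable_plane.
rewrite openE => p [Dp fp]; apply: filterI; first exact: open_nbhs_nbhs.
apply: (cf p Dp); apply: open_nbhs_nbhs; split => //.
Qed.

Lemma bounded_integrable (D : set M2) (f : P -> R) (M : R) :
  measurable D -> ((mu \x mu)%E D < +oo)%E -> measurable_fun D f ->
  (forall p, D p -> `|f p| <= M) -> ((mu \x mu)%E).-integrable D (EFin \o f).
Proof.
move=> mD Dfin mf fM; apply: measurable_bounded_integrable => //.
exists M; split; first exact: num_real.
by move=> x Mx p /fM /le_trans; apply; exact: ltW.
Qed.

Lemma measure_rectangle (s t : bool) (x1 x2 y1 y2 : R) : x1 <= x2 -> y1 <= y2 ->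
  (mu \x mu)%E ([set` Interval (BSide s x1) (BSide t x2)] `*` `]y1, y2[)
    = ((x2 - x1) * (y2 - y1))%:E.
Proof.
move=> x12 y12; rewrite product_measure1E; [|exact: measurable_itv..].
have len (s' t' : bool) (c d : R) : c <= d ->
    mu [set` Interval (BSide s' c) (BSide t' d)] = (d - c)%:E.
  move=> cd; rewrite lebesgue_measure_itv /= lte_fin.
  by case: ltgtP cd => // -> _; rewrite subrr.
by rewrite EFinM; congr (_ * _)%E; exact: len.
Qed.

Lemma integral_le_cst (D : set M2) (f : P -> R) (c m : R) : 0 <= c -> measurable D ->
  measurable_fun D f -> (forall p, D p -> 0 <= f p <= c) -> ((mu \x mu)%E D = m%:E) ->
  (\int[(mu \x mu)%E]_(p in D) (f p)%:E <= (c * m)%:E)%E.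
Proof.
move=> c0 mD mf fc Dm; rewrite EFinM -Dm -integral_cst //.
apply: ge0_le_integral => //.
- by move=> p /fc /andP[f0 _]; rewrite lee_fin.
- exact/measurable_EFinP.
- by move=> p /fc /andP[_ f1]; rewrite lee_fin.
Qed.

Lemma integral_d_line (f g : R -> R) (c : R) : 0 < c -> continuous f -> continuous g ->
  (forall t : R, is_derive t 1 f (g t)) -> (forall t : R, c <= `|t| -> f t = 0 /\ g t = 0) ->
  (\int[mu]_t (g t)%:E = 0)%E.
Proof.
move=> c0 cf cg dfg z.
have -> : (\int[mu]_t (g t)%:E = \int[mu]_(t in `[(- c)%R, c%R]) (g t)%:E)%E.
  rewrite [RHS]integral_mkcond; apply: eq_integral => t _.
  rewrite patchE; case: ifPn => //; rewrite notin_setE /= in_itv /= => /negP.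
  rewrite -ler_norml -ltNge => /ltW /z[_ ->] //.
rewrite (@continuous_FTC2 _ g f); first last.
- by move=> t _; rewrite derive1E; exact: derive_val.
- split => [t _| |]; first by have [] := dfg t.
    exact/cvg_at_right_filter/cf.
  exact/cvg_at_left_filter/cf.
- by apply: continuous_subspaceT => t; exact: cg.
- lra.
have -> : f c = 0 by have [] := z c (ler_norm c).
have -> : f (- c) = 0 by have [] := z (- c); rewrite ?normrN ?ler_norm.
by rewrite -EFinB subrr.
Qed.

Lemma continuous_bounded_box (f : P -> R) (c : R) : 0 <= c -> continuous f ->
  exists M, forall p, `|p.1| <= c -> `|p.2| <= c -> `|f p| <= M.
Proof.
move=> c0 cf.
have [||p _ pmax] := compact_EVT_max (f := fun p => `|f p|) _ (@compact_box R c).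
- by exists (0, 0); rewrite /= normr0.
- apply: continuous_subspaceT => p; apply: (continuous_comp (cf p)).
  exact: norm_continuous.
by exists `|f p| => q q1 q2; apply: pmax; rewrite inE.
Qed.

Lemma continuous_line (h : P -> R) (x : R) : continuous h ->
  continuous (fun t : R => h (x, t)) /\ continuous (fun t : R => h (t, x)).
Proof.
move=> ch; split=> t; apply/cvgrPdist_lt => e e0.
  have /cvg_boxP/(_ e e0)[d d0 hd] := ch (x, t).
  apply/nbhs_ballP; exists d => //= s st; rewrite distrC.
  by apply: hd => /=; [rewrite subrr normr0|rewrite distrC].
have /cvg_boxP/(_ e e0)[d d0 hd] := ch (t, x).
apply/nbhs_ballP; exists d => //= s st; rewrite distrC.
by apply: hd => /=; [rewrite distrC|rewrite subrr normr0].
Qed.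

(** Fubini with the variable of differentiation innermost reduces to the line, where the fundamental
    theorem of calculus gives 0. *)
Lemma integral_d_plane (i : bool) (f g : P -> R) (c : R) : 0 < c ->
  continuous f -> continuous g ->
  (forall p, if i then is_derive p.2 1 (fun t => f (p.1, t)) (g p)
             else is_derive p.1 1 (fun t => f (t, p.2)) (g p)) ->
  (forall p, c <= `|p.1| \/ c <= `|p.2| -> f p = 0 /\ g p = 0) ->
  (\int[@leb2 R]_p (g p)%:E = 0)%E.
Proof.
move=> c0 cf cg dfg z; rewrite /leb2.
have mg : measurable_fun (setT : set M2) g.
  by apply: continuous_on_open_measurable => [|p _]; [exact: openT|exact: cg].
have [M hM] := continuous_bounded_box (ltW c0) cg.
pose B : set M2 := `]- c, c[ `*` `]- c, c[.
have mB : measurable B by apply: measurableX; exact: measurable_itv.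
have ig : ((mu \x mu)%E).-integrable setT (EFin \o g).
  rewrite (_ : EFin \o g = (EFin \o g) \_ B); last first.
    apply/funext => p; rewrite patchE; case: ifPn => //; rewrite notin_setE => nB.
    have [|_ /= -> //] := z p.
    have [h|h] := leP c `|p.1|; [by left|right; rewrite leNgt; apply/negP => h'].
    by apply: nB; rewrite /B /= !in_itv /= -!ltr_norml.
  apply: (integrable_mkcond _ mB).1; apply: (@bounded_integrable _ _ M) => //.
  - by rewrite measure_rectangle ?ltry //; lra.
  - exact: measurable_funS mg.
  - move=> p; rewrite /B /= !in_itv /= -!ltr_norml => -[p1 p2].
    by apply: hM; exact: ltW.
case: i dfg => dfg.
  rewrite -(integral12_prod_meas1 ig) /fubini_F /=; apply: integral0_eq => x _.
  apply: (@integral_d_line (fun t => f (x, t)) (fun t => g (x, t)) c) => //.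
  - exact: (continuous_line x cf).1.
  - exact: (continuous_line x cg).1.
  - by move=> t; exact: dfg (x, t).
  - by move=> t ct; apply: z; right.
rewrite -(integral21_prod_meas1 ig) /fubini_G /=; apply: integral0_eq => x _.
apply: (@integral_d_line (fun t => f (t, x)) (fun t => g (t, x)) c) => //.
- exact: (continuous_line x cf).2.
- exact: (continuous_line x cg).2.
- by move=> t; exact: dfg (t, x).
- by move=> t ct; apply: z; left.
Qed.

Lemma ext0_measurable (Om : set P) (f : P -> R) : open Om ->
  (forall p, Om p -> {for p, continuous f}) ->
  measurable_fun (setT : set M2) (ext0 Om f).
Proof.
move=> oOm cf; have -> : ext0 Om f = f \_ Om.
  by apply/funext => p; rewrite /ext0 patchE /in_mem /= /mem /=.
apply/(measurable_restrictT (D := Om : set M2)); first exact: open_measurable_plane.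
exact: continuous_on_open_measurable.
Qed.

End PlaneIntegral.

(** * A continuously differentiable truncation *)

Section Truncation.
Variable R : realType.
Implicit Types e t : R.

(* A [C^1] approximation of [max t 0]: it vanishes for [t <= e] and equals
   [(t - e)^2 / t] for [e <= t]. *)
Definition trunc e t : R := Num.max (t - e) 0 ^+ 2 / (Num.max (t - e) 0 + e).
Definition dtrunc e t : R := 1 - e ^+ 2 / (Num.max (t - e) 0 + e) ^+ 2.

Lemma trunc_le e t : t <= e -> trunc e t = 0.
Proof. by move=> te; rewrite /trunc max_r ?subr_le0 // expr0n mul0r. Qed.

Lemma dtrunc_le e t : 0 < e -> t <= e -> dtrunc e t = 0.
Proof.
move=> e0 te; rewrite /dtrunc max_r ?subr_le0 // add0r divff ?subrr //.
by rewrite expf_neq0 // gt_eqF.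
Qed.

Lemma trunc_ge e t : e <= t -> trunc e t = (t - e) ^+ 2 / t.
Proof. by move=> te; rewrite /trunc max_l ?subr_ge0 // subrK. Qed.

Lemma dtrunc_ge e t : e <= t -> dtrunc e t = 1 - e ^+ 2 / t ^+ 2.
Proof. by move=> te; rewrite /dtrunc max_l ?subr_ge0 // subrK. Qed.

(** At the junction [t = e] the right increment is [h^2 / (e + h)], which is at most [k * h] once
    [h < k * e]. *)
Lemma is_derive_trunc e t : 0 < e -> is_derive t 1 (trunc e) (dtrunc e t).
Proof.
move=> e0; have [te|te|->] := ltgtP t e.
- rewrite dtrunc_le // ?ltW //.
  apply: (@is_derive_loc _ (cst 0) _ _ _ (e - t)); first by rewrite subr_gt0.
  move=> s; rewrite ltr_distl => /andP[_ se]; rewrite trunc_le //; lra.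
- rewrite dtrunc_ge ?(ltW te) //.
  apply: (@is_derive_loc _ (fun s => (s - e) ^+ 2 / s) _ _ _ (t - e)).
  + by rewrite subr_gt0.
  + move=> s; rewrite ltr_distl => /andP[se _]; rewrite trunc_ge //; lra.
  + have t0 : t != 0 by rewrite gt_eqF //; lra.
    have d1 : is_derive t 1 (fun s : R => (s - e) ^+ 2) (2 * (t - e)).
      by apply: is_derive_eq; rewrite /GRing.scale /=; ring.
    have := is_derive_div (g := id) t0 d1 (is_derive_id t 1).
    by move=> h; apply: is_derive_eq; field.
- rewrite dtrunc_le //; apply/is_derive_epsP => k k0.
  exists (k * e) => [|h hd]; first exact: mulr_gt0.
  rewrite (trunc_le (lexx e)) subr0 mul0r subr0.
  have [h0|h0] := leP h 0.
    by rewrite trunc_le ?normr0 ?mulr_ge0 // ?(ltW k0) //; lra.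
  rewrite trunc_ge; last lra.
  rewrite (_ : e + h - e = h); last by ring.
  rewrite gtr0_norm // in hd; rewrite (gtr0_norm h0).
  have eh : 0 < e + h by lra.
  rewrite ger0_norm; last by rewrite divr_ge0 ?sqr_ge0 // ltW.
  by rewrite ler_pdivrMr //; nra.
Qed.

Lemma continuous_trunc e : 0 < e -> continuous (trunc e) /\ continuous (dtrunc e).
Proof.
move=> e0; split => t.
  apply: differentiable_continuous; apply/derivable1_diffP.
  by have [] := is_derive_trunc t e0.
have cs : {for t, continuous (fun t : R => Num.max (t - e) 0 + e)}.
  apply: continuousD; last exact: cvg_cst.
  apply: continuous_max; last exact: cvg_cst.
  by apply: continuousB => //; exact: cvg_cst.
have s0 : Num.max (t - e) 0 + e != 0.
  by rewrite gt_eqF // ltr_wpDl // le_max lexx orbT.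
suff : {for t, continuous (fun t : R => 1 - e ^+ 2 / (Num.max (t - e) 0 + e) ^+ 2)} by [].
apply: continuousB; first exact: cvg_cst.
apply: continuousM; first exact: cvg_cst.
apply: continuousV; first by rewrite expf_neq0.
exact: (continuousM cs cs).
Qed.

Lemma trunc_approx e t : 0 < e -> 0 <= t -> 0 <= trunc e t <= t /\ `|trunc e t - t| <= 2 * e.
Proof.
move=> e0 t0; have [te|te] := leP t e.
  rewrite trunc_le // lexx t0 sub0r normrN ger0_norm //; split => //; lra.
have t0' : 0 < t by lra.
rewrite trunc_ge ?(ltW te) //.
have -> : (t - e) ^+ 2 / t = t - 2 * e + e * (e / t) by field; rewrite gt_eqF.
have et : e / t <= 1 by rewrite ler_pdivrMr // mul1r ltW.
have et0 : 0 < e / t by rewrite divr_gt0.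
have eet : e * (e / t) <= e by rewrite ler_piMr // ltW.
have eet0 : 0 < e * (e / t) by rewrite mulr_gt0.
split; last by rewrite ler_norml; lra.
apply/andP; split; last lra.
have -> : t - 2 * e + e * (e / t) = (t - e) ^+ 2 / t by field; rewrite gt_eqF.
by rewrite divr_ge0 ?sqr_ge0.
Qed.

Lemma dtrunc_bounds e t : 0 < e -> 0 <= dtrunc e t <= 1.
Proof.
move=> e0; have [te|te] := leP t e; first by rewrite dtrunc_le // lexx ler01.
have t0 : 0 < t by lra.
rewrite dtrunc_ge ?(ltW te) //.
have : e ^+ 2 / t ^+ 2 <= 1 by rewrite ler_pdivrMr ?exprn_gt0 //; nra.
have : 0 <= e ^+ 2 / t ^+ 2 by rewrite divr_ge0 ?sqr_ge0.
lra.
Qed.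

Lemma dtrunc_approx e t : 0 < e -> e <= t -> `|dtrunc e t - 1| <= e / t.
Proof.
move=> e0 te; have t0 : 0 < t by lra.
rewrite dtrunc_ge // addrAC subrr add0r normrN ger0_norm; last by rewrite divr_ge0 ?sqr_ge0.
have -> : e ^+ 2 / t ^+ 2 = e / t * (e / t) by field; rewrite gt_eqF.
by rewrite ler_piMr ?ler_pdivrMr ?mul1r // divr_ge0 // ltW.
Qed.

End Truncation.

(** * Integration by parts across the free boundary *)

Section WeakGradient.
Variable R : realType.
Notation P := (R * R)%type.
Notation mu := (@lebesgue_measure R).
Local Notation M2 := (measurableTypeR R * measurableTypeR R)%type.
Implicit Types (p q : P).

Lemma continuous_loc (f h : P -> R) p (e : R) : 0 < e ->
  (forall q, `|q.1 - p.1| < e -> `|q.2 - p.2| < e -> f q = h q) ->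
  {for p, continuous h} -> {for p, continuous f}.
Proof.
move=> e0 fh /cvg_boxP ch; apply/cvg_boxP => k /ch[d d0 hd].
exists (Num.min d e) => [|q]; first by rewrite lt_min d0.
rewrite !lt_min => /andP[q1 q1'] /andP[q2 q2'].
by rewrite !fh ?subrr ?normr0 //; exact: hd.
Qed.

Definition partial (i : bool) (f : P -> R) p (l : R) : Prop :=
  if i then is_derive p.2 1 (fun t => f (p.1, t)) l
  else is_derive p.1 1 (fun t => f (t, p.2)) l.

Lemma partial_loc i (f h : P -> R) p (e l : R) : 0 < e ->
  (forall q, `|q.1 - p.1| < e -> `|q.2 - p.2| < e -> f q = h q) ->
  partial i h p l -> partial i f p l.
Proof.
move=> e0 fh; case: i => /=; apply: (is_derive_loc e0) => t te; rewrite fh //=.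
  by rewrite subrr normr0.
by rewrite subrr normr0.
Qed.

Lemma partial_cst i (c : R) p : partial i (fun=> c) p 0.
Proof. by case: i; exact: is_derive_cst. Qed.

Lemma partialM i (f h : P -> R) p (l k : R) : partial i f p l -> partial i h p k ->
  partial i (fun q => f q * h q) p (l * h p + f p * k).
Proof.
case: p => x y; case: i => /= df dh.
  have := @is_deriveM _ _ (fun t => f (x, t)) (fun t => h (x, t)) y 1 l k df dh.
  by move=> H; apply: is_derive_eq; rewrite /GRing.scale /=; ring.
have := @is_deriveM _ _ (fun t => f (t, y)) (fun t => h (t, y)) x 1 l k df dh.
by move=> H; apply: is_derive_eq; rewrite /GRing.scale /=; ring.
Qed.

Lemma partial_comp i (f : P -> R) (h : R -> R) p (l k : R) : partial i f p l ->
  is_derive (f p) 1 h k -> partial i (fun q => h (f q)) p (k * l).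
Proof.
case: p => x y; case: i => /= df dh.
  exact: (@is_derive1_comp _ h (fun t => f (x, t))).
exact: (@is_derive1_comp _ h (fun t => f (t, y))).
Qed.

(** An interior zero of a nonnegative function is a minimum. At such a point [dtrunc e (u p)] is 0
    for every [e] and cannot tend to 1, so the limit of the truncated gradients is correct only
    because the gradient vanishes there. *)
Lemma partial_at_zero i (Om : set P) (u : P -> R) p (l : R) : open Om ->
  (forall q, Om q -> 0 <= u q) -> (forall q, Om q -> exists k, partial i u q k) ->
  Om p -> u p = 0 -> partial i u p l -> l = 0.
Proof.
case: p => x y oOm u0 du Op up dl; have [e e0 he] := open_boxP oOm Op.
have min0 (f : R -> R) (c : R) : (forall t, `|t - c| < e -> exists k, is_derive t 1 f k) ->
    f c = 0 -> (forall t, `|t - c| < e -> 0 <= f t) -> is_derive c 1 f l -> l = 0.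
  move=> df fc f0 dc.
  have itvE t : (t \in `]c - e, c + e[) = (`|t - c| < e).
    by rewrite in_itv /= ltr_distl.
  have : is_derive c 1 f 0.
    apply: (@derive1_at_min _ f (c - e) (c + e)).
    - lra.
    - by move=> t; rewrite itvE => /df[k []].
    - by rewrite itvE subrr normr0.
    - by move=> t; rewrite itvE fc => /f0.
  by move=> h; rewrite -(@derive_val _ _ _ _ _ _ _ dc) (@derive_val _ _ _ _ _ _ _ h).
case: i du dl => /= du dl.
  apply: (min0 (fun t => u (x, t)) y) => // t te.
    by apply: (du (x, t)); apply: he => //=; rewrite subrr normr0.
  by apply: u0; apply: he => //=; rewrite subrr normr0.
apply: (min0 (fun t => u (t, y)) x) => // t te.
  by apply: (du (t, y)); apply: he => //=; rewrite subrr normr0.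
by apply: u0; apply: he => //=; rewrite subrr normr0.
Qed.

Lemma RectE b p : Rect b p <-> 0 < p.1 < 1 /\ - b < p.2 < b.
Proof. by rewrite /Rect /= !in_itv. Qed.

Lemma open_Rect (b : R) : open (Rect b).
Proof.
rewrite openE => p /RectE[/andP[p1 p2] /andP[p3 p4]]; apply/nbhs_boxP.
exists (Num.min (Num.min p.1 (1 - p.1)) (Num.min (p.2 + b) (b - p.2))).
  by rewrite !lt_min; apply/andP; split; apply/andP; split; lra.
move=> q; rewrite !lt_min => /andP[/andP[a1 a2] _] /andP[_ /andP[a3 a4]].
apply/RectE; rewrite !ltr_norml in a1 a2 a3 a4.
by split; lra.
Qed.

Lemma Rect_measure (b : R) : 0 < b -> measurable (Rect b : set M2) /\
  ((mu \x mu)%E (Rect b) < +oo)%E.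
Proof.
move=> b0; split; first exact: (open_measurable_plane (@open_Rect b)).
by rewrite measure_rectangle ?ltry //; lra.
Qed.

(** Near a point of the rectangle outside [Om] one has [u < e], so [trunc e] of [u] is locally zero
    and its extension is [C^1] across the free boundary. The bound [M] on the gradient provides the
    domination as [e] tends to 0. *)
Lemma ext0_by_parts i (b M : R) (Om C : set P) (u g phi dphi : P -> R) : 0 < b -> open Om ->
  (forall p, Om p -> [/\ {for p, continuous u}, {for p, continuous g} & partial i u p (g p)]) ->
  (forall p, Om p -> 0 <= u p <= 1) ->
  (forall p, Om p -> Rect b p -> `|g p| <= M) ->
  (forall p, Rect b p -> ~ Om p -> forall e, 0 < e -> exists2 d : R, 0 < d &
     forall q, Om q -> `|q.1 - p.1| < d -> `|q.2 - p.2| < d -> u q < e) ->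
  continuous phi -> continuous dphi -> (forall p, partial i phi p (dphi p)) ->
  closed C -> C `<=` Rect b -> (forall p, ~ C p -> phi p = 0) ->
  (\int[@leb2 R]_(p in Rect b) (ext0 Om u p * dphi p)%:E
    = - \int[@leb2 R]_(p in Rect b) (ext0 Om g p * phi p)%:E)%E.
Proof.
move=> b0 oOm hu u01 gM bd cphi cdphi dphi' clC CU phi0; rewrite /leb2.
have [mU fU] := Rect_measure b0.
have Cbox p : ~ C p -> exists2 d : R, 0 < d &
    forall q, `|q.1 - p.1| < d -> `|q.2 - p.2| < d -> ~ C q.
  move=> nC; have oC : open (~` C) by exact: closed_openC.
  exact: (open_boxP oC nC).
have dphi0 p : ~ C p -> dphi p = 0.
  move=> nC; have [d d0 hd] := Cbox p nC.
  have : partial i phi p 0.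
    apply: (partial_loc (h := fun=> 0) d0); last exact: partial_cst.
    by move=> q q1 q2; apply: phi0; exact: hd.
  have := dphi' p; case: (i) => /= h1 h2.
    by rewrite -(@derive_val _ _ _ _ _ _ _ h1) (@derive_val _ _ _ _ _ _ _ h2).
  by rewrite -(@derive_val _ _ _ _ _ _ _ h1) (@derive_val _ _ _ _ _ _ _ h2).
pose f e p := if `[< Om p >] then trunc e (u p) else 0.
pose h e p := if `[< Om p >] then dtrunc e (u p) * g p else 0.
have reg e p : 0 < e -> Rect b p ->
    [/\ {for p, continuous (f e)}, {for p, continuous (h e)} & partial i (f e) p (h e p)].
  move=> e0 Up; have [ct cdt] := continuous_trunc e0.
  have [Op|nOp] := pselect (Om p).
    have [d d0 hd] := open_boxP oOm Op.
    have [cu cg du] := hu p Op; split.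
    - apply: (continuous_loc (h := fun q => trunc e (u q)) d0).
        by move=> q q1 q2; rewrite /f asboolT //; exact: hd.
      exact: (continuous_comp cu (ct (u p))).
    - apply: (continuous_loc (h := fun q => dtrunc e (u q) * g q) d0).
        by move=> q q1 q2; rewrite /h asboolT //; exact: hd.
      exact: (continuousM (continuous_comp cu (cdt (u p))) cg).
    - apply: (partial_loc (h := fun q => trunc e (u q)) d0).
        by move=> q q1 q2; rewrite /f asboolT //; exact: hd.
      rewrite /h asboolT //; apply: partial_comp du _.
      exact: is_derive_trunc.
  have [d d0 hd] := bd p Up nOp e e0.
  have fz q : `|q.1 - p.1| < d -> `|q.2 - p.2| < d -> f e q = 0.
    by move=> q1 q2; rewrite /f; case: asboolP => // Oq; rewrite trunc_le // ltW // hd.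
  have hz q : `|q.1 - p.1| < d -> `|q.2 - p.2| < d -> h e q = 0.
    by move=> q1 q2; rewrite /h; case: asboolP => // Oq; rewrite dtrunc_le ?mul0r // ltW // hd.
  split.
  - by apply: (continuous_loc (h := fun=> 0) d0 fz); exact: cvg_cst.
  - by apply: (continuous_loc (h := fun=> 0) d0 hz); exact: cvg_cst.
  - rewrite [h e p]hz ?subrr ?normr0 //.
    by apply: (partial_loc (h := fun=> 0) d0 fz); exact: partial_cst.
have f01 e p : 0 < e -> `|f e p| <= 1.
  move=> e0; rewrite /f; case: asboolP => Op; last by rewrite normr0.
  have /andP[u0 u1] := u01 p Op; have [/andP[t0 t1] _] := trunc_approx e0 u0.
  by rewrite ger0_norm // (le_trans t1).
have hM e p : 0 < e -> Rect b p -> `|h e p| <= `|M|.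
  move=> e0 Up; rewrite /h; case: asboolP => Op; last by rewrite normr0.
  have /andP[t0 t1] := dtrunc_bounds (u p) e0.
  rewrite normrM ger0_norm // -[leRHS]mul1r; apply: ler_pM => //.
  exact: le_trans (gM p Op Up) (ler_norm M).
have b1 : 0 <= b + 1 by lra.
have [K1 hK1] := continuous_bounded_box b1 cphi.
have [K2 hK2] := continuous_bounded_box b1 cdphi.
have {}hK1 : forall p, Rect b p -> `|phi p| <= `|K1|.
  move=> p /RectE[? ?]; apply: le_trans (ler_norm K1); apply: hK1; rewrite ?ler_norml; lra.
have {}hK2 : forall p, Rect b p -> `|dphi p| <= `|K2|.
  move=> p /RectE[? ?]; apply: le_trans (ler_norm K2); apply: hK2; rewrite ?ler_norml; lra.
have mfd e : 0 < e -> measurable_fun (Rect b : set M2) (fun p => f e p * dphi p).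
  move=> e0; apply: continuous_on_open_measurable; first exact: open_Rect.
  move=> p Up; have [cf _ _] := reg e p e0 Up.
  exact: (continuousM cf (@cdphi p)).
have mhp e : 0 < e -> measurable_fun (Rect b : set M2) (fun p => h e p * phi p).
  move=> e0; apply: continuous_on_open_measurable; first exact: open_Rect.
  move=> p Up; have [_ ch _] := reg e p e0 Up.
  exact: (continuousM ch (@cphi p)).
have bfd e p : 0 < e -> Rect b p -> `|f e p * dphi p| <= `|K2|.
  move=> e0 Up; rewrite normrM -[leRHS]mul1r; apply: ler_pM => //; first exact: f01.
  exact: hK2.
have bhp e p : 0 < e -> Rect b p -> `|h e p * phi p| <= `|M| * `|K1|.
  by move=> e0 Up; rewrite normrM; apply: ler_pM => //; [exact: hM|exact: hK1].
have parts e : 0 < e -> (\int[(mu \x mu)%E]_(p in Rect b) (f e p * dphi p)%:E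
    = - \int[(mu \x mu)%E]_(p in Rect b) (h e p * phi p)%:E)%E.
  move=> e0.
  (* The product is [C^1] on the whole plane: on [C] both factors are regular, and off the closed
     set [C] it is locally zero. The integral of its derivative [G] therefore vanishes. *)
  pose F p := f e p * phi p; pose G p := h e p * phi p + f e p * dphi p.
  have FG p : [/\ {for p, continuous F}, {for p, continuous G} & partial i F p (G p)].
    have [Cp|nCp] := pselect (C p).
      have [cf ch df] := reg e p e0 (CU p Cp); split.
      - exact: (continuousM cf (@cphi p)).
      - exact: (continuousD (continuousM ch (@cphi p)) (continuousM cf (@cdphi p))).
      - exact: partialM.
    have [d d0 hd] := Cbox p nCp.
    have Fz q : `|q.1 - p.1| < d -> `|q.2 - p.2| < d -> F q = 0.
      by move=> q1 q2; rewrite /F phi0 ?mulr0 //; exact: hd.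
    have Gz q : `|q.1 - p.1| < d -> `|q.2 - p.2| < d -> G q = 0.
      by move=> q1 q2; rewrite /G phi0 ?dphi0 ?mulr0 ?addr0 //; exact: hd.
    split.
    - by apply: (continuous_loc (h := fun=> 0) d0 Fz); exact: cvg_cst.
    - by apply: (continuous_loc (h := fun=> 0) d0 Gz); exact: cvg_cst.
    - rewrite [G p]Gz ?subrr ?normr0 //.
      by apply: (partial_loc (h := fun=> 0) d0 Fz); exact: partial_cst.
  have c0 : 0 < b + 1 by lra.
  have := @integral_d_plane R i F G (b + 1) c0 (fun p => let: And3 a _ _ := FG p in a)
    (fun p => let: And3 _ a _ := FG p in a) (fun p => let: And3 _ _ a := FG p in a).
  rewrite /leb2 => intG.
  have {intG} : (\int[(mu \x mu)%E]_(p in Rect b) (G p)%:E = 0)%E.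
    rewrite -[RHS]intG; last first.
      move=> p pb; have nC : ~ C p.
        move=> /CU /RectE[/andP[p1 p2] p3]; case: pb; rewrite leNgt ltr_norml.
          by move=> /negP; apply; lra.
        by move=> /negP; apply; lra.
      by rewrite /F /G phi0 // dphi0 // !mulr0 addr0.
    rewrite integral_mkcond; apply: eq_integral => p _; rewrite patchE.
    case: ifPn => //; rewrite notin_setE => nU.
    have nC : ~ C p by move=> /CU.
    by rewrite /G phi0 // dphi0 // !mulr0 addr0.
  rewrite /G; under eq_integral do rewrite EFinD.
  rewrite integralD //; first last.
  - by apply: bounded_integrable => //; [exact: mfd|move=> p; exact: bfd].
  - by apply: bounded_integrable => //; [exact: mhp|move=> p; exact: bhp].
  set I1 := (\int[_]_(_ in _) _)%E; set I2 := (\int[_]_(_ in _) _)%E => I12.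
  have f1 : I1 \is a fin_num.
    apply: integrable_fin_num => //.
    by apply: bounded_integrable => //; [exact: mhp|move=> p; exact: bhp].
  by rewrite -[LHS]add0e -(subee f1) addeAC I12 add0e.
pose e_ (n : nat) : R := n.+1%:R^-1.
have e_0 n : 0 < e_ n by rewrite invr_gt0.
have e_cvg : e_ @ \oo --> 0 by exact: cvg_harmonic.
have e_le (k : R) : 0 < k -> \forall n \near \oo, e_ n < k.
  move=> k0; move/cvgrPdist_lt : e_cvg => /(_ k k0); apply: filterS => n.
  by rewrite sub0r normrN gtr0_norm.
have cst_int (k : R) : ((mu \x mu)%E).-integrable (Rect b) (EFin \o cst k).
  by apply: (bounded_integrable (M := `|k|)).
have lim1 : (\int[(mu \x mu)%E]_(p in Rect b) (f (e_ n) p * dphi p)%:E)%E @[n --> \oo] -->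
    (\int[(mu \x mu)%E]_(p in Rect b) (ext0 Om u p * dphi p)%:E)%E.
  have [] := @dominated_convergence _ _ _ (mu \x mu)%E (Rect b) mU
    (fun n p => (f (e_ n) p * dphi p)%:E) (fun p => (ext0 Om u p * dphi p)%:E)
    (EFin \o cst `|K2|) => //.
  - by move=> n; apply/measurable_EFinP; exact: mfd.
  - apply/measurable_EFinP; apply: measurable_funM.
      apply: measurable_funS (@ext0_measurable _ _ u oOm _) => //.
      by move=> p /hu[].
    apply: measurable_funS (@continuous_on_open_measurable _ setT dphi openT _) => // p _.
    exact: cdphi.
  - apply: aeW => p Up; apply: cvg_EFin; first by apply: nearW => n.
    apply: cvgM; last exact: cvg_cst.
    apply/cvgrPdist_le => k k0; rewrite /ext0 /f; case: asboolP => Op; last first.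
      by apply: nearW => n; rewrite subrr normr0 ltW.
    have /andP[u0 _] := u01 p Op; have k20 : 0 < k / 2 by lra.
    apply: filterS (e_le _ k20) => n en; rewrite distrC.
    have [_ /le_trans] := trunc_approx (e_0 n) u0; apply; lra.
  - by apply: aeW => p n Up; rewrite lee_fin; exact: bfd.
have lim2 : (\int[(mu \x mu)%E]_(p in Rect b) (h (e_ n) p * phi p)%:E)%E @[n --> \oo] -->
    (\int[(mu \x mu)%E]_(p in Rect b) (ext0 Om g p * phi p)%:E)%E.
  have [] := @dominated_convergence _ _ _ (mu \x mu)%E (Rect b) mU
    (fun n p => (h (e_ n) p * phi p)%:E) (fun p => (ext0 Om g p * phi p)%:E)
    (EFin \o cst (`|M| * `|K1|)) => //.
  - by move=> n; apply/measurable_EFinP; exact: mhp.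
  - apply/measurable_EFinP; apply: measurable_funM.
      apply: measurable_funS (@ext0_measurable _ _ g oOm _) => //.
      by move=> p /hu[].
    apply: measurable_funS (@continuous_on_open_measurable _ setT phi openT _) => // p _.
    exact: cphi.
  - apply: aeW => p Up; apply: cvg_EFin; first by apply: nearW => n.
    apply: cvgM; last exact: cvg_cst.
    apply/cvgrPdist_le => k k0; rewrite /ext0 /h; case: asboolP => Op; last first.
      by apply: nearW => n; rewrite subrr normr0 ltW.
    have /andP[] := u01 p Op; rewrite le_eqVlt => /orP[/eqP u0|u0] _.
      have [_ _ du] := hu p Op.
      have -> : g p = 0.
        apply: (partial_at_zero oOm _ _ Op (esym u0) du).
          by move=> q /u01 /andP[].
        by move=> q /hu[_ _ ?]; exists (g q).
      by apply: nearW => n; rewrite mulr0 subrr normr0 ltW.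
    have g1 : 0 < `|g p| + 1 by rewrite ltr_wpDl.
    have m0 : 0 < Num.min (u p) (k / (`|g p| + 1) * u p).
      by rewrite lt_min u0 /= mulr_gt0 // divr_gt0.
    apply: filterS (e_le _ m0) => n; rewrite lt_min => /andP[eu ek].
    rewrite distrC -[X in `|_ - X|]mul1r -mulrBl normrM.
    have := dtrunc_approx (e_0 n) (ltW eu) => dt.
    apply: le_trans (_ : k / (`|g p| + 1) * (`|g p| + 1) <= _); last by rewrite divfK // gt_eqF.
    apply: ler_pM => //; last by rewrite lerDl.
    by apply: le_trans dt _; rewrite ler_pdivrMr // ltW.
  - by apply: aeW => p n Up; rewrite lee_fin; exact: bhp.
have E : (fun n => \int[(mu \x mu)%E]_(p in Rect b) (f (e_ n) p * dphi p)%:E)%E =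
    (fun n => - \int[(mu \x mu)%E]_(p in Rect b) (h (e_ n) p * phi p)%:E)%E.
  by apply/funext => n; exact: parts.
rewrite E in lim1; apply: (cvg_unique _ lim1) => //.
exact: cvgeN.
Qed.

End WeakGradient.

(** * Convergence *)

Section Convergence.
Variable R : realType.
Notation P := (R * R)%type.
Notation mu := (@lebesgue_measure R).
Local Notation M2 := (measurableTypeR R * measurableTypeR R)%type.
Implicit Types (p q : P).

Section FixedSolution.
Variables (a : R) (Om : set P) (u : P -> R) (psi : R -> R).
Hypothesis gs : graph_solution a Om u psi.

Lemma continuous_u p : Om p -> [/\ {for p, continuous u},
  {for p, continuous (d1 u)} & {for p, continuous (d2 u)}].
Proof. by case: (gs) => _ [_ [[C1u _] _] _ _ _] _ /C1u[]. Qed.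

Lemma kappa_small : 300 <= a -> 900 / a ^+ 2 <= 1 / 100.
Proof. by move=> a300; rewrite ler_pdivrMr ?exprn_gt0 //; nra. Qed.

(** For [x < 1/2] the interior estimate with [e = 1/4] gives [16 * 900/a^2 <= 16/100], for larger
    [x] the bound is 40; 41 covers both. *)
Lemma gradient_bounded b p : 300 <= a -> 8 * b <= a -> Om p -> Rect b p ->
  `|d1 u p| <= 41 /\ `|d2 u p| <= 41.
Proof.
case: p => x y a300 ba Op /RectE[/= /andP[x0 x1] yb].
have ya : `|y| <= a / 8 by rewrite ler_norml; lra.
have [x12|x12] := leP (1 / 2) x.
  have [h1 h2] := gradient_near_graph gs a300 ya Op x12.
  by split; [apply: le_trans h1 _|apply: le_trans h2 _]; rewrite ler_nat.
have k1 := kappa_small a300.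
have e4 : 0 < (1 / 4 : R) <= 1 / 4 by lra.
have a32 : 32 <= a by lra.
have k4 : 900 / a ^+ 2 <= 1 / 4 by lra.
have x2 : x <= 1 - 2 * (1 / 4) by lra.
have [] := gradient_inside gs a32 e4 k4 ya Op x2.
have -> : 4 * (900 / a ^+ 2) / (1 / 4) = 16 * (900 / a ^+ 2) by field; rewrite gt_eqF //; lra.
move=> h1 h2; split; last by apply: le_trans h2 _; clear - gs k1; lra.
have : `|d1 u (x, y) + 1 - 1| <= `|d1 u (x, y) + 1| + `|1| by exact: ler_normB.
by rewrite addrK normr1; clear - gs h1 k1; lra.
Qed.

Lemma u_vanishes b p e : 0 < e -> 8 * b <= a -> Rect b p -> ~ Om p ->
  exists2 d : R, 0 < d & forall q, Om q ->
    `|q.1 - p.1| < d -> `|q.2 - p.2| < d -> u q < e.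
Proof.
move=> e0 ba /RectE[/andP[p0 _] _] nOp.
have [clp|nclp] := pselect (closure Om p).
  have /cvg_within_boxP/(_ e e0)[d d0 hd] := u_bdry gs (conj clp nOp) p0.
  exists d => // q Oq q1 q2; have := hd q Oq q1 q2.
  by rewrite subr0; apply: le_lt_trans; exact: ler_norm.
have oC : open (~` closure Om) by apply: closed_openC; exact: closed_closure.
have [d d0 hd] := open_boxP oC nclp; exists d => // q Oq q1 q2.
by case: (hd q q1 q2); exact: subset_closure.
Qed.

Lemma weak_grad_u b : 0 < b -> 300 <= a -> 8 * b <= a ->
  weak_grad (Rect b) (ext0 Om u) (ext0 Om (d1 u)) (ext0 Om (d2 u)).
Proof.
move=> b0 a300 ba phi [C1phi [C [cC CU phi0]]].
have clC : closed C by apply: compact_closed cC; exact: norm_hausdorff.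
have cphi : continuous phi by move=> p; case: (C1phi p I) => _ h _ _; exact: h.
have c1 : continuous (d1 phi) by move=> p; case: (C1phi p I) => _ _ h _; exact: h.
have c2 : continuous (d2 phi) by move=> p; case: (C1phi p I) => _ _ _ h; exact: h.
have u01 p : Om p -> 0 <= u p <= 1 by exact: u_bounds gs _.
have van p : Rect b p -> ~ Om p -> forall e, 0 < e -> exists2 d : R, 0 < d &
    forall q, Om q -> `|q.1 - p.1| < d -> `|q.2 - p.2| < d -> u q < e.
  by move=> Up nOp e e0; exact: u_vanishes e0 ba Up nOp.
split.
  have hu p : Om p -> [/\ {for p, continuous u}, {for p, continuous (d1 u)}
      & partial false u p (d1 u p)].
    move=> Op; have [cu cu1 _] := continuous_u Op.
    by split; [exact: cu|exact: cu1|exact: (is_derive_u gs Op).1].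
  have g41 p : Om p -> Rect b p -> `|d1 u p| <= 41.
    by move=> Op Up; exact: (gradient_bounded a300 ba Op Up).1.
  have dphi p : partial false phi p (d1 phi p).
    by case: (C1phi p I) => -[h _] _ _ _; exact: is_derive_d1 h.
  exact: (ext0_by_parts b0 (open_Om gs) hu u01 g41 van cphi c1 dphi clC CU phi0).
have hu p : Om p -> [/\ {for p, continuous u}, {for p, continuous (d2 u)}
    & partial true u p (d2 u p)].
  move=> Op; have [cu _ cu2] := continuous_u Op.
  by split; [exact: cu|exact: cu2|exact: (is_derive_u gs Op).2].
have g41 p : Om p -> Rect b p -> `|d2 u p| <= 41.
  by move=> Op Up; exact: (gradient_bounded a300 ba Op Up).2.
have dphi p : partial true phi p (d2 phi p).
  by case: (C1phi p I) => -[_ h] _ _ _; exact: is_derive_d2 h.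
exact: (ext0_by_parts b0 (open_Om gs) hu u01 g41 van cphi c2 dphi clC CU phi0).
Qed.

Lemma d1_uS p : d1 (@uS R) p = -1.
Proof.
have H := is_deriveB (is_derive_cst (1 : R) p.1 1) (is_derive_id p.1 1).
rewrite /d1 derive1E -[RHS]sub0r.
exact: (@derive_val _ _ _ _ _ _ _ H).
Qed.

Lemma d2_uS p : d2 (@uS R) p = 0.
Proof.
by rewrite /d2 derive1E; exact: (@derive_val _ _ _ _ _ _ _ (is_derive_cst (1 - p.1) p.2 1)).
Qed.

(** The rectangle is cut at [x = 1 - 2 e]. To the left, [900/a^2 <= e^2] turns the gradient error
    [4 (900/a^2) / e] into [4 e], and the integrand is at most [e^2 + 16 e^2 + 16 e^2]. To the
    right, on area [4 b e], it is at most [1 + 42^2 + 41^2 < 3500]. *)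
Lemma H1dist2_u_le b (e : R) : 0 < b -> 300 <= a -> 8 * b <= a -> 0 < e <= 1 / 20 ->
  900 / a ^+ 2 <= e ^+ 2 ->
  (0 <= H1dist2_uS (Rect b) (ext0 Om u) (ext0 Om (d1 u)) (ext0 Om (d2 u))
     <= (15000 * b * e)%:E)%E.
Proof.
move=> b0 a300 ba /andP[e0 e1] ke.
pose J p := (ext0 Om u p - uS p) ^+ 2 + (ext0 Om (d1 u) p - d1 (@uS R) p) ^+ 2
  + (ext0 Om (d2 u) p - d2 (@uS R) p) ^+ 2.
rewrite (_ : H1dist2_uS _ _ _ _ = \int[(mu \x mu)%E]_(p in Rect b) (J p)%:E)%E //.
have JE p : J p = (ext0 Om u p - (1 - p.1)) ^+ 2 + (ext0 Om (d1 u) p + 1) ^+ 2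
  + ext0 Om (d2 u) p ^+ 2 by rewrite /J (d1_uS p) (d2_uS p) subr0 opprK.
have J0 p : 0 <= J p by rewrite !addr_ge0 // sqr_ge0.
apply/andP; split; first by apply: integral_ge0 => p _; rewrite lee_fin J0.
have a32 : 32 <= a by lra.
set k := 900 / a ^+ 2 in ke.
have a0 : 0 < a by lra.
have k0 : 0 < k by apply: divr_gt0; [rewrite ltr0n|exact: exprn_gt0].
have oOm : open Om := open_Om gs.
have mJ : measurable_fun (setT : set M2) J.
  have mf f : (forall p, Om p -> {for p, continuous f}) ->
      measurable_fun (setT : set M2) (ext0 Om f) by exact: ext0_measurable.
  have mS : measurable_fun (setT : set M2) (fun p : P => 1 - p.1).
    apply: continuous_on_open_measurable => [|p _]; first exact: openT.
    by apply: continuousB; [exact: cvg_cst|exact: cvg_fst].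
  rewrite (_ : J = fun p => (ext0 Om u p - (1 - p.1)) ^+ 2 + (ext0 Om (d1 u) p + 1) ^+ 2
    + ext0 Om (d2 u) p ^+ 2); last exact/funext.
  apply: measurable_funD; last first.
    by apply: measurable_funX; apply: mf => p /continuous_u[].
  apply: measurable_funD; apply: measurable_funX.
    by apply: measurable_funB => //; apply: mf => p /continuous_u[].
  by apply: measurable_funD => //; apply: mf => p /continuous_u[].
pose A : set M2 := `]0, 1 - 2 * e] `*` `]- b, b[.
pose B : set M2 := `]1 - 2 * e, 1[ `*` `]- b, b[.
have mA : measurable A by apply: measurableX; exact: measurable_itv.
have mB : measurable B by apply: measurableX; exact: measurable_itv.
have UE : Rect b = A `|` B.
  apply/seteqP; split => [[x y]|[x y] [[]|[]]]; rewrite /Rect /A /B /= !in_itv /=.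
  - move=> [/andP[x0 x1] yb]; have [h|h] := leP x (1 - 2 * e); [left|right].
      by rewrite x0.
    by rewrite x1.
  - by move=> /andP[x0 x1] ?; split => //; lra.
  - by move=> /andP[x0 x1] ?; split => //; lra.
have sq (s t : R) : `|s| <= t -> s ^+ 2 <= t ^+ 2.
  by move=> st; rewrite -real_normK ?num_real // lerXn2r ?nnegrE // (le_trans _ st).
have b8 y : - b < y < b -> `|y| <= a / 8 by move=> ?; rewrite ler_norml; lra.
have JOm x y : - b < y < b -> 0 < x -> Om (x, y) -> (u (x, y) - (1 - x)) ^+ 2 <= (k * x) ^+ 2.
  move=> /b8 ya x0 Op; have ya4 : `|y| <= a / 4 by lra.
  have := u_strip gs a32 ya4 Op; rewrite -/k => h.
  exact: sq.
rewrite UE ge0_integral_setU //; last 3 first.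
- by apply/measurable_EFinP; exact: measurable_funS mJ.
- by move=> p _; rewrite lee_fin.
- apply/disj_setPS => -[x y] []; rewrite /A /B /= !in_itv /=.
  by move=> [/andP[_ h1] _] [/andP[h2 _] _]; lra.
have -> : 15000 * b * e = 33 * e ^+ 2 * ((1 - 2 * e - 0) * (b - - b)) +
    (15000 * b * e - 33 * e ^+ 2 * ((1 - 2 * e - 0) * (b - - b))) by ring.
rewrite EFinD; apply: leeD.
  apply: integral_le_cst => //.
  - by rewrite mulr_ge0 // sqr_ge0.
  - exact: measurable_funS mJ.
  - move=> [x y]; rewrite /A /= !in_itv /= => -[/andP[x0 x1] yb].
    rewrite J0 JE /=; have ya := b8 y yb.
    have ya' : - a <= y <= a by move: ya; rewrite ler_norml; lra.
    have Op : Om (x, y).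
      apply/(Om_graph gs) => //; rewrite x0 /=.
      have ya4 : `|y| <= a / 4 by lra.
      have /andP[_] := psi_strip gs a32 ya4; have := psi_gt0 gs ya'.
      by rewrite -/k; nra.
    rewrite /ext0 asboolT //=.
    have e4 : 0 < e <= 1 / 4 by lra.
    have ke' : k <= e by nra.
    have [h1 h2] := gradient_inside gs a32 e4 ke' ya Op x1.
    rewrite -/k in h1 h2; have h3 := JOm x y yb x0 Op.
    have ke4 : 4 * k / e <= 4 * e by clear - gs ke e0; rewrite ler_pdivrMr //; lra.
    clear ya ya' yb Op.
    have {}h1 : (d1 u (x, y) + 1) ^+ 2 <= (4 * e) ^+ 2.
      by apply: sq; exact: le_trans ke4.
    have {}h2 : d2 u (x, y) ^+ 2 <= (4 * e) ^+ 2.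
      by apply: sq; exact: le_trans ke4.
    have h4 : (k * x) ^+ 2 <= e ^+ 2.
      have kx0 : 0 <= k * x by rewrite mulr_ge0 ?(ltW k0) ?(ltW x0).
      have kxe : k * x <= e.
        by apply: le_trans ke'; rewrite ler_piMr ?(ltW k0) //; lra.
      by rewrite lerXn2r ?nnegrE ?(ltW e0).
    lra.
  - by clear - gs e0 e1 b0; rewrite measure_rectangle //; lra.
apply: (@le_trans _ _ (3500 * ((1 - (1 - 2 * e)) * (b - - b)))%:E); last first.
  rewrite lee_fin; have eb : 0 < b * e by rewrite mulr_gt0.
  have e2 : e ^+ 2 * b <= b * e by rewrite [leLHS]mulrC ler_pM2l //; nra.
  have e3 : 0 <= e ^+ 2 * b * e by rewrite mulr_ge0 ?mulr_ge0 ?sqr_ge0 // ltW.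
  lra.
have c0 : 0 <= (3500 : R) by rewrite ler0n.
apply: (integral_le_cst c0 mB).
- exact: measurable_funS mJ.
- move=> [x y]; rewrite /B /= !in_itv /= => -[/andP[x0 x1] yb].
  have x0' : 0 < x by clear - gs x0 e1; lra.
  rewrite J0 JE /= /ext0; case: asboolP => Op /=.
    have h3 := JOm x y yb x0' Op.
    have Uxy : Rect b (x, y) by apply/RectE; rewrite /= x0' x1.
    have [g1 g2] := gradient_bounded a300 ba Op Uxy.
    have k1 := kappa_small a300; rewrite -/k in k1.
    have kx : k * x <= 1.
      apply: (@le_trans _ _ k); first by rewrite ler_piMr ?(ltW k0) ?(ltW x1).
      by apply: le_trans k1 _; rewrite ler_pdivrMr ?mul1r ?ler1n // ltr0n.
    have kx2 : (k * x) ^+ 2 <= 1 by rewrite exprn_ile1 // mulr_ge0 ?(ltW k0) ?(ltW x0').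
    have h1 : (d1 u (x, y) + 1) ^+ 2 <= 42 ^+ 2.
      apply: sq; apply: le_trans (ler_normD _ _) _; rewrite normr1.
      by clear - gs g1; lra.
    have h2 := sq _ _ g2.
    by clear - gs h1 h2 h3 kx2; lra.
  (* Outside [Om] the extended function and gradient are 0, and the integrand is [(1 - x)^2 + 1]. *)
  rewrite sub0r sqrrN add0r expr1n expr0n /= addr0.
  have : (1 - x) ^+ 2 <= 1 by rewrite exprn_ile1 ?subr_ge0 ?gerBl ?(ltW x1) ?(ltW x0').
  by clear - gs; lra.
- by clear - gs e0 e1 b0; rewrite measure_rectangle //; lra.
Qed.

End FixedSolution.

Lemma H1dist2_u_cvg (Om : R -> set P) (u : R -> P -> R) (psi : R -> R -> R) b :
  0 < b -> (forall a, 0 < a -> graph_solution a (Om a) (u a) (psi a)) ->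
  (fun a => H1dist2_uS (Rect b) (ext0 (Om a) (u a)) (ext0 (Om a) (d1 (u a)))
     (ext0 (Om a) (d2 (u a)))) @ +oo --> 0%E.
Proof.
move=> b0 gs.
have [c c0 hc] : exists2 c : R, 0 < c & forall a e, 300 <= a -> 8 * b <= a ->
    0 < e <= 1 / 20 -> 900 / a ^+ 2 <= e ^+ 2 ->
    (0 <= H1dist2_uS (Rect b) (ext0 (Om a) (u a)) (ext0 (Om a) (d1 (u a)))
       (ext0 (Om a) (d2 (u a))) <= (c * b * e)%:E)%E.
  eexists; last first.
    move=> a e a300 ba e01 ae.
    have a0 : 0 < a by apply: lt_le_trans a300; rewrite ltr0n.
    have H := H1dist2_u_le (gs a a0) b0 a300 ba e01 ae; exact: H.
  by rewrite ltr0n.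
have main (k : R) : 0 < k -> \forall a \near +oo,
    (0 <= H1dist2_uS (Rect b) (ext0 (Om a) (u a)) (ext0 (Om a) (d1 (u a)))
       (ext0 (Om a) (d2 (u a))) <= k%:E)%E.
  move=> k0; have cb : 0 < c * b by rewrite mulr_gt0.
  have [e [e0 e1 ek]] : exists e : R, [/\ 0 < e, e <= 1 / 20 & c * b * e <= k].
    exists (Num.min (1 / 20) (k / (c * b))); split.
    - by rewrite lt_min (divr_gt0 k0 cb) andbT divr_gt0 ?ltr0n.
    - by rewrite ge_min lexx.
    - by rewrite mulrC -(ler_pdivlMr _ _ cb) ge_min lexx orbT.
  have e2 : 0 < e ^+ 2 by rewrite exprn_gt0.
  have e9 : 0 < 900 / e ^+ 2 by apply: divr_gt0 e2; rewrite ltr0n.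
  (* As [a >= 1], the bound [a >= 900 / e^2] also gives [a^2 >= 900 / e^2]. *)
  exists (300 + 8 * b + 900 / e ^+ 2); split; first exact: num_real.
  move=> a ha; have [a300 ba ae] : [/\ 300 <= a, 8 * b <= a & 900 / e ^+ 2 <= a].
    move: e9 ha; move: (900 / e ^+ 2) => w; clear - b0 => w0 ha.
    by split; lra.
  have e01 : 0 < e <= 1 / 20 by rewrite e0.
  have a1 : 1 <= a by apply: le_trans a300; rewrite ler1n.
  have a20 : 0 < a ^+ 2 by rewrite exprn_gt0 // (lt_le_trans ltr01).
  have ae2 : 900 / a ^+ 2 <= e ^+ 2.
    rewrite (ler_pdivrMr _ _ a20) mulrC -(ler_pdivrMr _ _ e2).
    by apply: le_trans ae _; rewrite expr2 ler_peMr // (le_trans ler01).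
  have /andP[-> h] := hc a e a300 ba e01 ae2.
  by rewrite /= (le_trans h) // lee_fin.
apply/fine_cvgP; split.
  apply: filterS (main 1 ltr01) => a /andP[h0 h1].
  by rewrite ge0_fin_numE // (le_lt_trans h1) // ltry.
apply/cvgrPdist_le => k k0; apply: filterS (main k k0) => a /andP[h0 h1] /=.
rewrite sub0r normrN ger0_norm ?fine_ge0 // -lee_fin fineK //.
by rewrite ge0_fin_numE // (le_lt_trans h1) // ltry.
Qed.

(** With [k = 900/a^2], [psi_strip] says that [|psi - 1| <= k * psi]; since [psi <= 2], it is enough
    that [k < e / 2], which is where [1800 / e] comes from. *)
Lemma psi_cvg (Om : R -> set P) (u : R -> P -> R) (psi : R -> R -> R) (b e : R) :
  0 < b -> 0 < e -> (forall a, 0 < a -> graph_solution a (Om a) (u a) (psi a)) ->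
  \forall a \near +oo, forall y, - b <= y <= b -> `|psi a y - 1| < e.
Proof.
move=> b0 e0 gs.
have [w [w0 we]] : exists w, 0 < w /\ w * e = 1800.
  exists (1800 / e); split; first by apply: divr_gt0 e0; rewrite ltr0n.
  by rewrite divfK // gt_eqF.
exists (300 + 8 * b + w); split; first exact: num_real.
move=> a ha y yb.
have [a300 ba wa] : [/\ 300 <= a, 8 * b <= a & w < a] by clear we; split; lra.
have a0 : 0 < a by apply: lt_le_trans a300; rewrite ltr0n.
have a32 : 32 <= a by apply: le_trans a300; rewrite ler_nat.
have ya : `|y| <= a / 4 by clear - ba b0 yb; rewrite ler_norml; lra.
have ya' : - a <= y <= a by clear - ba b0 yb; lra.
have := psi_strip (gs a a0) a32 ya; have p0 := psi_gt0 (gs a a0) ya'.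
have k1 := kappa_small a300.
have k2 : 900 / a ^+ 2 < e / 2.
  rewrite ltr_pdivrMr ?exprn_gt0 //.
  have : w < a ^+ 2 by clear - wa a300; nra.
  by rewrite -(ltr_pM2l e0); clear - we; lra.
have k0 : 0 < 900 / a ^+ 2 by apply: divr_gt0; [rewrite ltr0n|exact: exprn_gt0].
move: k0 k1 k2; set k := 900 / a ^+ 2 => k0 k1 k2 /andP[h1 h2].
have p2 : psi a y <= 2 by clear - h1 k1 p0; nra.
by clear - h1 h2 k0 k2 p2; rewrite ltr_norml; apply/andP; split; nra.
Qed.

End Convergence.

Theorem theorem2 (R : realType) (Om : R -> set (R * R)) (u : R -> R * R -> R)
    (psi : R -> R -> R) :
  (forall a, 0 < a -> fb_solution a (Om a) (u a)) ->
  (forall a, 0 < a -> forall p : R * R,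
      (Gamma a (Om a) p /\ - a <= p.2 <= a) <-> (- a <= p.2 <= a /\ p.1 = psi a p.2)) ->
  (forall b : R, 0 < b -> forall e : R, 0 < e ->
     \forall a \near +oo, forall x2, - b <= x2 <= b -> `|psi a x2 - 1| < e) /\
  (forall b : R, 0 < b ->
     exists g1 g2 : R -> R * R -> R,
       (\forall a \near +oo,
          weak_grad (Rect b) (ext0 (Om a) (u a)) (g1 a) (g2 a)) /\
       ((fun a => H1dist2_uS (Rect b) (ext0 (Om a) (u a)) (g1 a) (g2 a))
          @ +oo --> 0%E)).
Proof.
move=> sol graph.
have gs a : 0 < a -> graph_solution a (Om a) (u a) (psi a).
  by move=> a0; split; [|exact: sol|exact: graph].
split=> [b b0 e e0|b b0]; first exact: psi_cvg gs.
exists (fun a => ext0 (Om a) (d1 (u a))), (fun a => ext0 (Om a) (d2 (u a))).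
split; last exact: H1dist2_u_cvg gs.
exists (300 + 8 * b); split; first exact: num_real.
move=> a ha; have a0 : 0 < a by lra.
by apply: (weak_grad_u (gs a a0)) => //; lra.
Qed.
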